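(* Let $n,m$ be integers with $2\le m\le\lfloor n/2\rfloor$ and let $G\in\mathbb{U}(n,m)$. \begin{itemize} \item If $n\le 2m+2$, then $W(G)\le 2-\frac83 m^3+2m^2+\frac53 m+2m^2n-3mn-2n+n^2$. \item If $n\ge 2m+3$ and $n$ is odd, then $W(G)\le \frac92-n-\frac23 m^3+\frac12 n^2-2nm+2m^2+\frac12 mn^2-\frac{11}{6}m$. \item If $n\ge 2m+4$ and $n$ is even, then $W(G)\le 6-n-\frac23 m^3+\frac12 n^2-2nm+2m^2+\frac12 mn^2-\frac73 m$. \end{itemize} Moreover, these bounds are sharp: for all integers $n,m$ with $2\le m\le\lfloor n/2\rfloor$, the bound applicable to $(n,m)$ is attained by some graph in $\mathbb{U}(n,m)$.
   Context: All graphs are finite, simple and connected. A unicyclic graph is a connected graph containing exactly one cycle. The matching number of a graph is the maximum size of a set of pairwise disjoint edges. $\mathbb{U}(n,m)$ denotes the set of unicyclic graphs with $n$ vertices and matching number $m$. The Wiener index of $G$ is $W(G)=\sum_{\{u,v\}\subset V(G)}d(u,v)$, the sum over unordered pairs of distinct vertices of the graph distance $d(u,v)$. *)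

(* Defs.v *)
From mathcomp Require Import all_boot all_order all_algebra.

Set Implicit Arguments.
Unset Strict Implicit.
Unset Printing Implicit Defensive.

Record sgraph := SGraph {
  svertex :> finType;
  sedge : rel svertex;
  sedge_sym : symmetric sedge;
  sedge_irrefl : irreflexive sedge
}.

Section GraphNotions.
Variable G : sgraph.

Definition edge_set : {set {set G}} :=
  [set [set p.1; p.2] | p : G * G & sedge p.1 p.2].

Definition connected_graph : Prop := forall x y : G, connect (@sedge G) x y.

(* A cycle is identified with its set of edges, so the choice of a starting
   vertex and of an orientation for the vertex sequence [c] is irrelevant. *)
Definition is_cycle (C : {set {set G}}) : Prop :=
  exists c : seq G,
    [/\ 3 <= size c, ucycle (@sedge G) c & C = [set [set x; next c x] | x in c]].

Definition unicyclic : Prop :=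
  connected_graph /\ exists! C : {set {set G}}, is_cycle C.

Definition is_matching (M : {set {set G}}) : bool :=
  (M \subset edge_set) && trivIset M.

Definition matching_number : nat :=
  \max_(M : {set {set G}} | is_matching M) #|M|.

Definition walk_of_length (x y : G) (k : nat) : bool :=
  [exists p : k.-tuple G, path (@sedge G) x p && (last x p == y)].

(* [find] returns the least k < #|G| such that there is a walk of length k from
   x to y, and #|G| when y cannot be reached from x. *)
Definition dist (x y : G) : nat := find (walk_of_length x y) (iota 0 #|G|).

(* The condition on [enum_rank] (the position of a vertex in [enum G]) selects
   exactly one of (x, y) and (y, x) for each pair of distinct vertices. *)
Definition wiener : nat :=
  \sum_(x : G) \sum_(y : G | enum_rank x < enum_rank y) dist x y.

Definition in_U (n m : nat) : Prop :=
  [/\ unicyclic, #|G| = n & matching_number = m].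

End GraphNotions.

Local Open Scope ring_scope.

Definition bound_small (n m : rat) : rat :=
  2 - 8 / 3 * m ^+ 3 + 2 * m ^+ 2 + 5 / 3 * m + 2 * m ^+ 2 * n - 3 * m * n
    - 2 * n + n ^+ 2.

Definition bound_odd (n m : rat) : rat :=
  9 / 2 - n - 2 / 3 * m ^+ 3 + 1 / 2 * n ^+ 2 - 2 * n * m + 2 * m ^+ 2
    + 1 / 2 * m * n ^+ 2 - 11 / 6 * m.

Definition bound_even (n m : rat) : rat :=
  6 - n - 2 / 3 * m ^+ 3 + 1 / 2 * n ^+ 2 - 2 * n * m + 2 * m ^+ 2
    + 1 / 2 * m * n ^+ 2 - 7 / 3 * m.

(* Main.v *)
(** Deleting an edge of the cycle of [G] leaves a spanning tree [T] whose matching number is at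
    most [m]. Rooted at a centroid, [T] has Wiener index equal to the sum of [s (n - s)] over
    the non-root vertices, where [s <= n / 2] is the size of the subtree. Choosing a child for
    every non-leaf vertex gives two matchings which together have one edge more than there are
    non-leaf vertices, so there are at most [2m - 1] of these; and since the subtrees are
    nested or disjoint, the two smallest ones among any [2j] of them have total size at most
    [n - 2j + 1]. By concavity of [s (n - s)] this bounds [W(T)].

    If [w_0, ..., w_(g-1)] are the sizes of the branches of [G] hanging on the cycle, then
    [W(T) - W(G)] is at least the sum of [w_i w_j max(0, 2 (j - i) - g)] over [i < j]. For a
    suitable choice of the deleted edge this is enough, except for three shapes of the cycle:
    a triangle with weights [(n - 2, 1, 1)], where deleting the edge between the light vertices
    costs a non-leaf vertex; a triangle with weights [(3, 3, 3)]; and a 4-cycle with weights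
    [(beta, 1, alpha, 1)], where [T] has an extra leaf inside the subtree of size [alpha + 1],
    which lowers the bound [n - 2j + 1] for all smaller subtrees. *)

Require Import Defs.
From mathcomp Require Import all_boot all_order all_algebra.
From mathcomp Require Import zify ring lra.
Import GRing.Theory.

Set Implicit Arguments.
Unset Strict Implicit.
Unset Printing Implicit Defensive.

(** * Distances *)

(** The reference value is [tree_bound n k] with [k = m - 1]: up to [2k] non-root vertices have a
    subtree with more than one vertex, they are bounded in [k] pairs, and every other non-root
    vertex contributes [n - 1]. The bounds of the theorem are [tree_bound n k] minus [n - 2] if
    [n <= 2m + 2], and minus [2 (n - 2 - a)], with [a] half of [n - 2m + 1] rounded up, otherwise.
    So opening the cycle has to lose that much, or the tree has to miss its own bound.

    The second constant comes from the 4-cycle with weights [(beta, 1, alpha, 1)]. Opening it loses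
    [2 beta = 2 (n - 2 - alpha)], which is enough for [alpha <= a]; for larger [alpha] the extra
    leaf costs the tree two units in each of at least [alpha - a] pairs. Outside the three
    exceptional shapes the loss is at least [2n - 8], the largest value that the required loss can
    take when [n >= 2m + 3].

    For sharpness the Wiener index of the extremal graph is only bounded from below; the upper bound
    then forces equality. The lower bound projects the graph to a path by a 1-Lipschitz coordinate,
    whose level sets play the role of the subtrees. *)

Section Distance.
Variable G : sgraph.
Implicit Types (x y z : G) (p : seq G).
Local Notation e := (@sedge G).

Lemma sedge_neq x y : e x y -> x != y.
Proof. by apply: contraTneq => ->; rewrite sedge_irrefl. Qed.

Lemma connect_sedge_sym : connect_sym e.
Proof. exact/sym_connect_sym/sedge_sym. Qed.

Lemma walkP x y k :
  reflect (exists p, [/\ path e x p, last x p = y & size p = k])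
          (walk_of_length x y k).
Proof.
apply: (iffP existsP) => [[p /andP[ep /eqP lp]]|[p [ep lp sp]]].
  by exists p; rewrite size_tuple.
by exists (Tuple (introT eqP sp)); rewrite ep lp eqxx.
Qed.

Lemma dist_le x y p : path e x p -> last x p = y -> dist x y <= size p.
Proof.
move=> ep lp; rewrite /dist leqNgt; apply/negP => lt_p.
have lt_pG : size p < #|G|.
  by apply: leq_trans lt_p _; rewrite -[leqRHS](size_iota 0); apply: find_size.
have := before_find 0 lt_p; rewrite nth_iota // add0n => /negbT/negP; apply.
by apply/walkP; exists p.
Qed.

Lemma dist_walk x y : connect e x y ->
  exists p, [/\ path e x p, last x p = y & size p = dist x y].
Proof.
case/connectP => p0 ep0 ->{y}; case: (shortenP ep0) => p ep up _ {p0 ep0}.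
have lt_pG : size p < #|G|.
  by have := max_card (mem (x :: p)); rewrite (card_uniqP up).
have hasw : has (walk_of_length x (last x p)) (iota 0 #|G|).
  apply/hasP; exists (size p); first by rewrite mem_iota.
  by apply/walkP; exists p.
have := nth_find 0 hasw; rewrite nth_iota ?add0n; first by move/walkP.
by rewrite -[ltnRHS](size_iota 0) -has_find.
Qed.

Lemma dist0 x : dist x x = 0.
Proof. by apply/eqP; rewrite -leqn0; apply: (@dist_le _ _ [::]). Qed.

Lemma dist_eq0 x y : connect e x y -> dist x y = 0 -> x = y.
Proof. by case/dist_walk=> [[|z p] [_ /= <- <-]]. Qed.

Lemma dist_edge x y : e x y -> dist x y <= 1.
Proof. by move=> exy; apply: (@dist_le _ _ [:: y]); rewrite //= exy. Qed.

Lemma dist_triangle y x z : connect e x y -> connect e y z ->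
  dist x z <= dist x y + dist y z.
Proof.
move=> /dist_walk[p [ep lp <-]] /dist_walk[q [eq lq <-]].
by rewrite -size_cat; apply: dist_le; rewrite ?cat_path ?last_cat lp ?ep.
Qed.

Lemma dist_sym x y : connect e x y -> dist x y = dist y x.
Proof.
have le_d u v : connect e u v -> dist v u <= dist u v.
  case/dist_walk=> p [ep <- <-].
  have <- : size (rev (belast u p)) = size p by rewrite size_rev size_belast.
  apply: dist_le; first by rewrite rev_path (eq_path (e' := e)) // => a b; apply: sedge_sym.
  by case: p {ep} => //= w p; rewrite rev_cons last_rcons.
move=> cxy; apply/eqP; rewrite eqn_leq !le_d //.
by rewrite connect_sedge_sym.
Qed.

(** Turns a potential [phi] into a lower bound on distances. It is applied to the opened tree, with
    heights and positions along the cycle, and to the extremal graphs, with their coordinate on a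
    path. *)
Lemma dist_lipschitz (phi : G -> nat) x y :
    (forall u v, e u v -> phi v <= phi u + 1) -> connect e x y ->
  phi y <= phi x + dist x y.
Proof.
move=> lip /dist_walk[p [ep <- <-]].
elim: p x ep => [|z p IHp] x /=; first by rewrite addn0.
by case/andP=> /lip exz /IHp; lia.
Qed.

Lemma dist_last_edge x y : connect e x y -> x != y ->
  exists2 z, e z y & dist x z + 1 = dist x y.
Proof.
move=> cxy ne_xy; have [p [ep lp sp]] := dist_walk cxy.
case/lastP: p ep lp sp => [_ /= eq_xy|p z]; first by rewrite eq_xy eqxx in ne_xy.
rewrite rcons_path last_rcons size_rcons => /andP[ep ez] eq_z sp.
rewrite {z}eq_z in ez; exists (last x p) => //.
have := dist_le ep erefl.
have c1 : connect e x (last x p) by apply/connectP; exists p.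
by have := dist_triangle c1 (connect1 ez); have := dist_edge ez; lia.
Qed.

End Distance.

Section Wiener.
Variable G : sgraph.
Hypothesis connG : connected_graph G.

Lemma wiener_double : (wiener G).*2 = \sum_(x : G) \sum_(y : G) dist x y.
Proof.
have part x : \sum_(y : G) dist x y =
    \sum_(y | enum_rank x < enum_rank y) dist x y +
    \sum_(y | enum_rank y < enum_rank x) dist x y.
  rewrite (bigID (fun y => enum_rank x < enum_rank y)) /=; congr (_ + _).
  rewrite (bigD1 x) /= ?ltnn // dist0 add0n; apply: eq_bigl => y.
  by rewrite -leqNgt andbC ltn_neqAle (inj_eq val_inj) (inj_eq enum_rank_inj).
rewrite (eq_bigr _ (fun x _ => part x)) big_split /= -addnn; congr (_ + _).
rewrite (exchange_big_dep xpredT) //=; apply: eq_bigr => x _.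
by apply: eq_bigr => y _; rewrite dist_sym.
Qed.

End Wiener.

Lemma card_reflect_sum (T : finType) (A : {set T}) : \sum_(x : T) (x \in A : nat) = #|A|.
Proof. by rewrite -big_mkcond sum1_card. Qed.

(** * Rooted trees *)

Lemma card_disjointU (T : finType) (A B : {set T}) :
  [disjoint A & B] -> #|A :|: B| = #|A| + #|B|.
Proof. by move=> AB; rewrite cardsU disjoint_setI0 // cards0 subn0. Qed.

Lemma disjoint_setU (T : finType) (A B C : {set T}) :
  [disjoint A :|: B & C] = [disjoint A & C] && [disjoint B & C].
Proof. by rewrite -!setI_eq0 setIUl setU_eq0. Qed.

Ltac card_lia :=
  repeat match goal with |- context [@bigop ?R ?I ?x ?e ?F] =>
    generalize (@bigop R I x e F) end;
  repeat match goal with |- context [@card ?T ?A] => generalize (@card T A) end;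
  clear; lia.

Section RootedTree.
Variables (V : finType) (r : V) (par : V -> V) (depth : V -> nat).
Hypothesis par_root : par r = r.
Hypothesis depth_par : forall v, v != r -> depth (par v) < depth v.
Implicit Types (u v w : V) (I Q : {set V}).

(** The rooted tree is abstracted to its parent function, with a depth that makes the iterates reach
    the root. The counting below is free of adjacency. *)
Definition subtree v : {set V} := [set u | fconnect par u v].
Local Notation sub := subtree.
Local Notation s v := #|subtree v|.

Lemma subtree_refl v : v \in sub v.
Proof. by rewrite inE connect0. Qed.

Lemma subtree_gt0 v : 0 < s v.
Proof. by apply/card_gt0P; exists v; apply: subtree_refl. Qed.

Lemma subtree_par u v : u \in sub v -> u = v \/ par u \in sub v.
Proof.
rewrite !inE => /iter_findex; case: (findex _ _ _) => [|k] /=; first by left.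
by rewrite -iterS iterSr => <-; right; apply: fconnect_iter.
Qed.

Lemma subtree_parW u v : par u \in sub v -> u \in sub v.
Proof. by rewrite !inE; apply: connect_trans; apply: fconnect1. Qed.

Lemma subtree_trans v u w : u \in sub v -> v \in sub w -> u \in sub w.
Proof. by rewrite !inE; apply: connect_trans. Qed.

Lemma parent_ind (P : V -> Prop) :
  P r -> (forall v, v != r -> P (par v) -> P v) -> forall v, P v.
Proof.
move=> Pr IH v; have [k le_vk] := ubnP (depth v); elim: k v le_vk => // k IHk v le_vk.
by have [->//|ne_vr] := eqVneq v r; apply/IH/IHk=> //; have := depth_par ne_vr; lia.
Qed.

Lemma subtree_root v : v \in sub r.
Proof.
elim/parent_ind: v => [|v _]; first exact: subtree_refl.
exact: subtree_parW.
Qed.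

Lemma root_in_subtree v : r \in sub v -> v = r.
Proof.
rewrite inE => /iter_findex <-; elim: findex => //= k ->; exact: par_root.
Qed.

Lemma root_notin_subtree v : v != r -> r \notin sub v.
Proof. by apply: contra => /root_in_subtree ->. Qed.

Lemma subtree_depth u v : v != r -> u \in sub v -> (u == v) || (depth v < depth u).
Proof.
move=> ne_vr; elim/parent_ind: u => [/root_in_subtree eq_v|u ne_ur IH uv].
  by rewrite eq_v eqxx in ne_vr.
case: (subtree_par uv) => [->|/IH]; first by rewrite eqxx.
have := depth_par ne_ur; case: (par u =P v) => [<- -> _|_ lt1 /= lt2]; first by rewrite orbT.
by rewrite (ltn_trans lt2 lt1) orbT.
Qed.

Lemma subtree_anti u v : v != r -> u \in sub v -> v \in sub u -> u = v.
Proof.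
move=> ne_vr uv vu; have ne_ur : u != r.
  by apply: contraTneq uv => ->; apply: root_notin_subtree.
have := subtree_depth ne_vr uv; have := subtree_depth ne_ur vu.
by case: eqP => [->//|_]; case: eqP => //= _; lia.
Qed.

Lemma subtreeS u v : u \in sub v -> sub u \subset sub v.
Proof. by move=> uv; apply/subsetP => w wu; apply: subtree_trans wu uv. Qed.

Lemma subtree_lt u v : v != r -> u \in sub v -> u != v -> s u < s v.
Proof.
move=> ne_vr uv ne_uv; apply/proper_card/properP; split; first exact: subtreeS.
exists v; first exact: subtree_refl.
by apply: contra ne_uv => vu; apply/eqP; apply: subtree_anti vu.
Qed.

(** Both [u] and [v] lie on the sequence of iterated parents of [w]; hence subtrees form a laminar
    family. *)
Lemma subtree_comparable w u v :
  w \in sub u -> w \in sub v -> u \in sub v \/ v \in sub u.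
Proof.
elim/parent_ind: w => [_ wv|w _ IH wu wv].
  by rewrite (root_in_subtree wv); left; apply: subtree_root.
case: (subtree_par wu) => [<-|pwu]; first by left.
case: (subtree_par wv) => [<-|pwv]; first by right.
exact: IH.
Qed.

Lemma subtree_disjoint u v : u \notin sub v -> v \notin sub u ->
  [disjoint sub u & sub v].
Proof.
move=> nuv nvu; rewrite disjoint_subset; apply/subsetP=> w wu; rewrite inE.
by apply/negP => wv; case: (subtree_comparable wu wv); apply/negP.
Qed.

Lemma child_subtree v w : w \in sub v -> w != v ->
  exists c, [/\ c != r, par c = v & w \in sub c].
Proof.
elim/parent_ind: w => [/root_in_subtree->|w ne_wr IH wv ne_wv]; first by rewrite eqxx.
case: (subtree_par wv) => [eq_wv|/IH {}IH]; first by rewrite eq_wv eqxx in ne_wv.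
have [eq_pw|/IH[c [ne_c pc wc]]] := eqVneq (par w) v.
  by exists w; rewrite subtree_refl.
by exists c; split=> //; apply: subtree_parW.
Qed.

(** * Counting in laminar families of subtrees *)

Section Laminar.
Variable n : nat.
Hypothesis cardV : #|V| = n.
Hypothesis centroid : forall v, v != r -> (s v).*2 <= n.

Section Exceptional.
(* [Q] holds at most one vertex, lying outside every subtree of size at most [al];
   with [Q = set0] the bounds below are the unrefined ones. *)
Variables (Q : {set V}) (al : nat).
Hypothesis cardQ : #|Q| <= 1.
Hypothesis rQ : r \notin Q.
Hypothesis al_small : Q != set0 -> al.*2 + 2 <= n.

Definition avoidsQ I :=
  [/\ r \notin I, [disjoint I & Q] &
      forall v q, v \in I -> q \in Q -> q \in sub v -> al < s v].

Lemma card_outside (A I : {set V}) : avoidsQ I -> r \notin A ->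
  [disjoint A & I] -> [disjoint A & Q] -> #|A| + #|I| + #|Q| < n.
Proof.
case=> rI IQ _ rA AI AQ.
have rU : r \notin A :|: (I :|: Q) by rewrite !in_setU !negb_or rA rI rQ.
have AU : [disjoint A & I :|: Q].
  by rewrite disjoint_sym disjoint_setU disjoint_sym AI disjoint_sym.
have := max_card (mem (r |: (A :|: (I :|: Q)))).
rewrite cardV cardsU1 rU card_disjointU // card_disjointU //; card_lia.
Qed.

Lemma avoidsQD1 I v : avoidsQ I -> avoidsQ (I :\ v).
Proof.
case=> rI IQ hI; split.
- by rewrite !inE negb_and rI orbT.
- by apply: disjointWl IQ; apply: subD1set.
- by move=> w q /setD1P[_ wI]; apply: hI.
Qed.

Lemma disjointQ I v : avoidsQ I -> v \in I -> s v <= al -> [disjoint sub v & Q].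
Proof.
case=> _ _ hI vI le_v; rewrite disjoint_sym disjoint_subset; apply/subsetP=> q qQ.
by rewrite inE; apply/negP => /(hI _ _ vI qQ); rewrite ltnNge le_v.
Qed.

(** If some member of [I] is not above [v], let [w] be the smallest such member: the subtrees of [v]
    and [w] are disjoint and contain no further member of [I], so together with these members and
    the root they fit into [n] vertices. Otherwise [I] is a chain above [v], and its top subtree, of
    size at most [n / 2] by the centroid property, contains [sub v] and all of [I]. *)
Lemma min_subtree I v : avoidsQ I -> v \in I -> (forall w, w \in I -> s v <= s w) ->
  s v <= al -> (s v).*2 + #|I| + #|Q| <= n + 1.
Proof.
move=> aI vI min_v le_v; have [rI IQ hI] := aI.
have nr w : w \in I -> w != r by apply: contraTneq => ->.
pose J := [set w in I | v \notin sub w].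
have Ivsub z : z \in I -> z != v -> z \notin sub v.
  move=> zI ne_z; apply/negP => /(subtree_lt (nr _ vI)) /(_ ne_z).
  by have := min_v z zI; card_lia.
have [J0|[w0 w0J]] := set_0Vmem J; last first.
  case: (arg_minnP (fun w => s w) w0J) => w wJ min_w {w0 w0J}.
  have /setIdP[wI nvw] : w \in J by [].
  have ne_wv : w != v by apply: contraNneq nvw => ->; apply: subtree_refl.
  have dvw : [disjoint sub v & sub w].
    by apply: subtree_disjoint => //; apply: Ivsub.
  have Iwsub z : z \in I -> z != w -> z \notin sub w.
    move=> zI ne_z; apply/negP => zw; have lt_z := subtree_lt (nr _ wI) zw ne_z.
    have : z \notin J by apply/negP => /min_w; rewrite leqNgt lt_z.
    by rewrite /J in_set zI negbK /= => /subtree_trans/(_ zw); apply/negP.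
  have cI : #|I| = #|I :\ v :\ w| + 2.
    by rewrite (cardsD1 v I) vI (cardsD1 w (I :\ v)) in_setD1 ne_wv wI; card_lia.
  have dA : [disjoint sub v :|: sub w & I :\ v :\ w].
    rewrite disjoint_sym disjoint_subset; apply/subsetP=> z.
    by case/setD1P=> zw /setD1P[zv zI]; rewrite inE in_setU negb_or Iwsub ?Ivsub.
  have rA : r \notin sub v :|: sub w.
    by rewrite in_setU negb_or !root_notin_subtree ?nr.
  have cA : #|sub v :|: sub w| = s v + s w.
    by rewrite cardsU disjoint_setI0 // cards0 subn0.
  have aI2 := avoidsQD1 w (avoidsQD1 v aI).
  have dv := disjointQ aI vI le_v.
  (* If [sub w] misses [Q], the exceptional vertex is one more vertex in the count. If not,
     [s w > al >= s v] supplies the missing unit. *)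
  have [qw|nqw] := boolP [disjoint sub w & Q].
    have dAQ : [disjoint sub v :|: sub w & Q] by rewrite disjoint_setU dv.
    by have := card_outside aI2 rA dA dAQ; rewrite cA cI; have := min_v w wI; card_lia.
  have lt_w : al < s w.
    by case/pred0Pn: nqw => q /andP[/= qw qQ]; apply: hI qw.
  have : #|sub v :|: sub w| + #|I :\ v :\ w| < n.
    have := max_card (mem (r |: (sub v :|: sub w :|: I :\ v :\ w))).
    rewrite cardV cardsU1 in_setU negb_or (negbTE rA) /= (_ : r \notin _); last by case: aI2.
    by rewrite (card_disjointU dA); card_lia.
  by move: cardQ le_v lt_w; rewrite cA cI; card_lia.
have vsub w : w \in I -> v \in sub w.
  move=> wI; apply/negPn/negP => nvw.
  by have : w \in J; [rewrite /J in_set wI | rewrite J0 in_set0].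
case: (arg_maxnP (fun w => s w) vI) => t tI max_t.
have sI : sub v :|: (I :\ v) \subset sub t.
  rewrite subUset subtreeS ?vsub //=; apply/subsetP => w /setD1P[ne_w wI].
  case: (subtree_comparable (vsub _ wI) (vsub _ tI)) => // tw.
  have [->|ne_tw] := eqVneq w t; first exact: subtree_refl.
  have := subtree_lt (nr _ wI) tw; rewrite eq_sym ne_tw => /(_ isT).
  by have := max_t w wI; card_lia.
have cI : #|I| = #|I :\ v| + 1 by rewrite (cardsD1 v I) vI; card_lia.
have := subset_leq_card sI; rewrite cardsU disjoint_setI0 ?cards0; last first.
  rewrite disjoint_sym disjoint_subset; apply/subsetP=> z.
  by case/setD1P=> zv zI; rewrite inE Ivsub.
have := centroid (nr _ tI); have := min_v t tI; have := max_t v vI.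
have [Q0|/set0Pn[q qQ]] := eqVneq Q set0; first by rewrite Q0 cards0 cI; card_lia.
have /al_small : Q != set0 by apply/set0Pn; exists q.
by move: cardQ le_v; rewrite cI; card_lia.
Qed.

(** For disjoint subtrees this is a count of vertices. If [v] lies below [v'], then [s v < s v'],
    and the bound on twice a smallest subtree, applied to [v'] in [I :\ v], is enough. *)
Lemma pair_subtree I v v' : avoidsQ I -> v \in I -> v' \in I :\ v ->
    (forall w, w \in I -> s v <= s w) -> (forall w, w \in I :\ v -> s v' <= s w) ->
    s v' <= al -> s v + s v' + #|I| + #|Q| <= n + 1.
Proof.
move=> aI vI v'Iv min_v min_v' le_v'; have [rI IQ hI] := aI.
case/setD1P: (v'Iv) => ne_v' v'I.
have nr w : w \in I -> w != r by apply: contraTneq => ->.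
have Isub x z : z \in I -> x \in I -> s x <= s z -> z != x -> z \notin sub x.
  move=> zI xI le_x ne_z; apply/negP => /(subtree_lt (nr _ xI)) /(_ ne_z).
  by move: le_x; card_lia.
have cI : #|I| = #|I :\ v| + 1 by rewrite (cardsD1 v I) vI; card_lia.
have [vv'|nvv'] := boolP (v \in sub v').
  have := min_subtree (avoidsQD1 v aI) v'Iv min_v' le_v'.
  by rewrite eq_sym in ne_v'; have := subtree_lt (nr _ v'I) vv' ne_v'; rewrite cI; card_lia.
have dvv : [disjoint sub v & sub v'].
  by apply: subtree_disjoint => //; apply: Isub => //; apply: min_v.
have cI' : #|I :\ v| = #|I :\ v :\ v'| + 1 by rewrite (cardsD1 v' (I :\ v)) v'Iv; card_lia.
have le_v : s v <= al by apply: leq_trans le_v'; apply: min_v.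
have rA : r \notin sub v :|: sub v'.
  by rewrite in_setU negb_or !root_notin_subtree ?nr.
have dA : [disjoint sub v :|: sub v' & I :\ v :\ v'].
  rewrite disjoint_sym disjoint_subset; apply/subsetP=> z /setD1P[zv' zIv].
  case/setD1P: (zIv) => zv zI; rewrite inE in_setU negb_or !Isub //.
    exact: min_v'.
  exact: min_v.
have := card_outside (avoidsQD1 v' (avoidsQD1 v aI)) rA dA.
rewrite disjoint_setU (disjointQ aI vI le_v) (disjointQ aI v'I le_v') => /(_ isT).
by rewrite card_disjointU // cI cI'; card_lia.
Qed.

End Exceptional.
End Laminar.
End RootedTree.

(** * Concavity of the cut function *)

(** The number of vertex pairs separated by an edge that splits [n] vertices into [s] and [n - s],
    which is the contribution of that edge to the Wiener index of a tree. *)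
Definition cut (n s : nat) : nat := s * (n - s).

Definition balanced_cuts (n S : nat) : nat := cut n S./2 + cut n (uphalf S).

Lemma le_cut n s t : s <= t -> s + t <= n -> cut n s <= cut n t.
Proof. by rewrite /cut => st stn; nia. Qed.

(** [cut n] increases up to [n / 2], so the smaller part may be raised until the sum is [S];
    concavity then favours equal parts. *)
Lemma le_balanced_cuts n S p q : S <= n -> p + q <= S ->
  cut n p + cut n q <= balanced_cuts n S.
Proof.
move=> Sn; wlog le_pq : p q / p <= q.
  move=> H pqS; case: (leqP p q) => [/H->//|/ltnW qp].
  by rewrite addnC; apply: H; rewrite // addnC.
move=> pqS; apply: (@leq_trans (cut n (S - q) + cut n q)).
  by rewrite leq_add2r le_cut; lia.
(* All quantities are now written through nonnegative differences, so that the truncated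
   subtractions disappear and a polynomial inequality remains. *)
have [d nd] : exists d, n = S + d by exists (n - S); lia.
have [x [t Sx]] : exists x t, S = x.*2 + t /\ t <= 1.
  by exists S./2, (odd S : nat); rewrite addnC odd_double_half; case: (odd S).
rewrite /balanced_cuts; have [-> ->] : S./2 = x /\ uphalf S = x + t by lia.
have [u qu] : exists u, q = x + t + u \/ q + u = x.
  by exists (q - (x + t) + (x - q)); lia.
have qS : q <= x.*2 + t by lia.
rewrite /cut; subst n; case: Sx qu qS => -> t1 [->|qu] qS.
  have -> : x.*2 + t - (x + t + u) = x - u by lia.
  have -> : x.*2 + t + d - (x + t + u) = x - u + d by lia.
  have -> : x.*2 + t + d - (x - u) = x + t + u + d by lia.
  have -> : x.*2 + t + d - x = x + t + d by lia.
  have -> : x.*2 + t + d - (x + t) = x + d by lia.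
  have [w ->] : exists w, x = u + w by exists (x - u); lia.
  by rewrite [u + w]addnC addnK; nia.
subst x; have -> : (q + u).*2 + t - q = q + u.*2 + t by lia.
have -> : (q + u).*2 + t + d - q = q + u.*2 + t + d by lia.
have -> : (q + u).*2 + t + d - (q + u.*2 + t) = q + d by lia.
have -> : (q + u).*2 + t + d - (q + u) = q + u + t + d by lia.
have -> : (q + u).*2 + t + d - (q + u + t) = q + u + d by lia.
by nia.
Qed.

(** Moving one unit from [q] to [p] raises the sum of cuts by [2 (q - p) - 2], which is at least
    two. *)
Lemma le_balanced_cuts_gap n S p q : S + 2 < n -> p + 2 <= q -> p + q <= S ->
  cut n p + cut n q + 2 <= balanced_cuts n S.
Proof.
move=> Sn pq pqS; apply: (@leq_trans (cut n p.+1 + cut n q.-1)); last first.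
  by apply: le_balanced_cuts; lia.
have [t [d [-> ->]]] : exists t d, q = p + 2 + t /\ n = p + p + t + d + 2.
  by exists (q - p - 2), (n - (p + q)); lia.
rewrite /cut; have -> : (p + 2 + t).-1 = p + t + 1 by lia.
have -> : p + p + t + d + 2 - p = p + t + d + 2 by lia.
have -> : p + p + t + d + 2 - (p + 2 + t) = p + d by lia.
have -> : p + p + t + d + 2 - p.+1 = p + t + d + 1 by lia.
have -> : p + p + t + d + 2 - (p + t + 1) = p + d + 1 by lia.
by nia.
Qed.

(** Passing from [S - 1] to [S] raises one part from [x] to [x + 1], with [x] half of [S - 1]
    rounded down. This adds [n - 2x - 1 >= n - S >= 3]. *)
Lemma le_balanced_cuts_lt n S p q : S + 2 < n -> p + q < S ->
  cut n p + cut n q + 2 <= balanced_cuts n S.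
Proof.
move=> Sn pqS; apply: (@leq_trans (balanced_cuts n S.-1 + 2)).
  by rewrite leq_add2r le_balanced_cuts; lia.
have [d nd] : exists d, n = S + 3 + d by exists (n - (S + 3)); lia.
have [x Sx] : exists x, S = x.*2.+1 \/ S = x.*2.+2 by exists (S.-1)./2; lia.
rewrite /balanced_cuts /cut; subst n; case: Sx => ->.
  have [-> -> -> ->] : [/\ x.*2.+1./2 = x, uphalf x.*2.+1 = x.+1,
    (x.*2.+1.-1)./2 = x & uphalf x.*2.+1.-1 = x] by split; lia.
  have -> : x.*2.+1 + 3 + d - x = x + 4 + d by lia.
  have -> : x.*2.+1 + 3 + d - x.+1 = x + 3 + d by lia.
  by nia.
have [-> -> -> ->] : [/\ x.*2.+2./2 = x.+1, uphalf x.*2.+2 = x.+1,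
  (x.*2.+2.-1)./2 = x & uphalf x.*2.+2.-1 = x.+1] by split; lia.
have -> : x.*2.+2 + 3 + d - x = x + 5 + d by lia.
have -> : x.*2.+2 + 3 + d - x.+1 = x + 4 + d by lia.
by nia.
Qed.

Lemma exists_card_between (T : finType) (A B : {set T}) k :
    A \subset B -> #|A| <= k -> k <= #|B| ->
  exists I : {set T}, [/\ A \subset I, I \subset B & #|I| = k].
Proof.
move=> AB Ak; elim: k Ak => [|k IHk] Ak kB.
  by exists A; rewrite AB; split=> //; lia.
have [<-|neA] := eqVneq #|A| k.+1; first by exists A.
case: IHk => [||I [AI IB cI]]; try lia.
have /subsetPn[x xB xI] : ~~ (B \subset I) by apply/negP => /subset_leq_card; lia.
exists (x |: I); rewrite cardsU1 xI cI; split=> //.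
  exact: subset_trans AI (subsetUr _ _).
by rewrite subUset sub1set xB.
Qed.

(** * Sums of cuts in a tree rooted at a centroid *)

Section Profile.
Variables (V : finType) (r : V) (par : V -> V) (depth : V -> nat).
Hypothesis par_root : par r = r.
Hypothesis depth_par : forall v, v != r -> depth (par v) < depth v.
Local Notation s v := #|subtree par v|.
Variable n : nat.
Hypothesis cardV : #|V| = n.
Hypothesis centroid : forall v, v != r -> (s v).*2 <= n.

Lemma avoids0 (I : {set V}) al : r \notin I -> avoidsQ r par set0 al I.
Proof.
by move=> rI; split=> // [|v q _]; rewrite ?inE // -setI_eq0 setI0.
Qed.

(** [I] may contain leaves besides the non-leaf vertices, so that its cardinality can be prescribed.
    Each vertex outside it contributes [cut n 1 = n - 1]. *)
Lemma cut_sum_leaves (I : {set V}) : r \notin I ->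
    [set v | (v != r) && (1 < s v)] \subset I ->
  \sum_(v | v != r) cut n (s v)
    <= \sum_(v in I) cut n (s v) + (n - #|I|.+1) * (n - 1).
Proof.
move=> rI NI; rewrite (bigID (mem I)) /=.
have -> : \sum_(v | (v != r) && (v \in I)) cut n (s v) = \sum_(v in I) cut n (s v).
  apply: eq_bigl => v; rewrite andbC; case: (boolP (v \in I)) => //= vI.
  by apply: contraTneq vI => ->.
rewrite leq_add2l; apply: (@leq_trans (\sum_(v in ~: (r |: I)) (n - 1))).
  rewrite [leqRHS](eq_bigl (fun v => (v != r) && (v \notin I))); last first.
    by move=> v; rewrite !inE negb_or.
  apply: leq_sum => v /andP[vr vI].
  have : v \notin [set v | (v != r) && (1 < s v)] by apply: contra vI => /(subsetP NI).
  rewrite inE vr /= -leqNgt => s1; have -> : s v = 1.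
    by apply/eqP; rewrite eqn_leq s1 subtree_gt0.
  by rewrite /cut mul1n.
by rewrite sum_nat_const cardsCs setCK cardsU1 cardV rI.
Qed.

Lemma min_pair (I : {set V}) : 1 < #|I| -> exists v v',
  [/\ v \in I, v' \in I :\ v, forall w, w \in I -> s v <= s w
    & forall w, w \in I :\ v -> s v' <= s w].
Proof.
move=> cI; have [x0 x0I] : exists x, x \in I by apply/card_gt0P; lia.
case: (arg_minnP (fun w => s w) x0I) => v vI minv {x0 x0I}; have {}vI : v \in I by [].
have [x0 x0I] : exists x, x \in I :\ v.
  by apply/card_gt0P; move: cI; rewrite (cardsD1 v) vI; card_lia.
case: (arg_minnP (fun w => s w) x0I) => v' v'I minv'.
by exists v, v'.
Qed.

Variables (Q : {set V}) (al : nat).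
Hypothesis cardQ : #|Q| <= 1.
Hypothesis rQ : r \notin Q.
Hypothesis al_small : Q != set0 -> al.*2 + 2 <= n.

(** The [j]-th pair has total size at most [S = n - 2j - 1]. When [S <= 2 al], either its larger
    subtree exceeds [al], so that the two sizes differ by at least two, or both subtrees miss the
    exceptional vertex and their total is at most [S - 1]. Either case costs two units. *)
Definition saving j : nat := if (Q != set0) && (n - j.*2.+1 <= al.*2) then 2 else 0.

(** The two smallest members are removed at each step. When [2j + 2] members are left, these two
    have total size at most [n - 2j - 1]. *)
Lemma le_profile (I : {set V}) k : avoidsQ r par Q al I -> #|I| = k.*2 ->
  \sum_(v in I) cut n (s v) + \sum_(j < k) saving j
    <= \sum_(j < k) balanced_cuts n (n - j.*2.+1).
Proof.
elim: k I => [|k IHk] I aI cI.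
  by rewrite !big_ord0 (cards0_eq cI) big_set0.
have [|v [v' [vI v'I minv minv']]] := @min_pair I; first by rewrite cI.
rewrite !big_ord_recr (big_setD1 v) // (big_setD1 v') //=.
have cD : #|I :\ v :\ v'| = k.*2.
  by move: cI; rewrite (cardsD1 v I) vI (cardsD1 v' (I :\ v)) v'I; card_lia.
have := IHk _ (avoidsQD1 v' (avoidsQD1 v aI)) cD.
have rI : r \notin I by case: aI.
have base := pair_subtree par_root depth_par cardV centroid (Q := set0) (al := n) _ _ _
  (avoids0 n rI) vI v'I minv minv'.
have {base} : s v + s v' + #|I| <= n + 1.
  move: base; rewrite cards0 inE eqxx addn0; apply=> //.
  by rewrite -cardV max_card.
have le_vv' : s v <= s v' by apply: minv; case/setD1P: v'I.
rewrite cI => base IH.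
have reorder a b c d e : a + (b + c) + (d + e) = c + d + (a + b + e) by lia.
rewrite reorder; apply: leq_add; first exact: IH.
rewrite /saving; case: ifP => [/andP[Q0 le_al]|_]; last first.
  by rewrite addn0; apply: le_balanced_cuts; move: base; card_lia.
have a2 := al_small Q0.
have [le_v'|lt_v'] := leqP (s v') al; last first.
  by apply: le_balanced_cuts_gap; move: base a2 le_al lt_v'; card_lia.
have := pair_subtree par_root depth_par cardV centroid cardQ rQ al_small aI vI v'I
  minv minv' le_v'.
have : 0 < #|Q| by rewrite card_gt0.
by rewrite cI => cQ ref; apply: le_balanced_cuts_lt; move: a2 le_al base ref cQ; card_lia.
Qed.

(** The non-leaf vertices are padded to exactly [2k] by leaves outside [Q]. A padding leaf has a
    one-point subtree, which cannot contain the exceptional vertex. *)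
Lemma le_cut_sum k :
    #|[set v | (v != r) && (1 < s v)]| <= k.*2 ->
    avoidsQ r par Q al [set v | (v != r) && (1 < s v)] ->
    k.*2 + #|Q| < n ->
  \sum_(v | v != r) cut n (s v) + \sum_(j < k) saving j
    <= \sum_(j < k) balanced_cuts n (n - j.*2.+1) + (n - k.*2.+1) * (n - 1).
Proof.
set N := [set v | _] => cN [rN NQ hN] kn.
have cB : #|~: (r |: Q)| = n - #|Q|.+1 by rewrite cardsCs setCK cardsU1 rQ cardV.
have NB : N \subset ~: (r |: Q).
  apply/subsetP => v vN; rewrite inE in_setU1 negb_or.
  rewrite (disjointFr NQ vN) andbT.
  by apply: contraTneq vN => ->.
have [|I [NI IB cI]] := exists_card_between NB cN.
  by rewrite cB; move: kn; card_lia.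
have aI : avoidsQ r par Q al I.
  split.
  - by apply/negP => /(subsetP IB); rewrite !inE eqxx.
  - rewrite disjoint_subset; apply/subsetP=> v /(subsetP IB); rewrite !inE negb_or.
    by case/andP.
  move=> v q vI qQ qv; have [vN|] := boolP (v \in N); first exact: hN qv.
  have /(subsetP IB) := vI; rewrite !inE negb_or => /andP[-> vQ] /=.
  rewrite -leqNgt => /card_le1P/(_ v (subtree_refl _ _)) => eq_sub.
  by move: qv; rewrite eq_sub inE => /eqP eq_q; rewrite -eq_q qQ in vQ.
have rI : r \notin I by case: aI.
have prof := le_profile aI cI; have := cut_sum_leaves rI NI; rewrite cI => leaves.
apply: leq_trans (leq_add leaves (leqnn _)) _.
by rewrite addnAC leq_add2r.
Qed.

End Profile.

Section OddProfile.
Variables (V : finType) (r : V) (par : V -> V) (depth : V -> nat).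
Hypothesis par_root : par r = r.
Hypothesis depth_par : forall v, v != r -> depth (par v) < depth v.
Local Notation s v := #|subtree par v|.
Variable n : nat.
Hypothesis cardV : #|V| = n.
Hypothesis centroid : forall v, v != r -> (s v).*2 <= n.

(** With [2k + 1] members the smallest one is removed on its own. Twice its size is at most
    [n - 2k]; the rest is treated in pairs. *)
Lemma le_cut_sum_odd k :
    #|[set v | (v != r) && (1 < s v)]| <= k.*2.+1 -> k.*2.+1 < n ->
  \sum_(v | v != r) cut n (s v)
    <= \sum_(j < k) balanced_cuts n (n - j.*2.+1) + cut n (n - k.*2)./2
       + (n - k.*2.+2) * (n - 1).
Proof.
move=> cN kn.
have NB : [set v | (v != r) && (1 < s v)] \subset ~: [set r].
  by apply/subsetP=> v; rewrite !inE => /andP[].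
have [|I [NI IB cI]] := exists_card_between NB cN.
  by rewrite cardsCs setCK cards1 cardV; move: kn; clear; lia.
have rI : r \notin I by apply/negP => /(subsetP IB); rewrite !inE eqxx.
apply: leq_trans (cut_sum_leaves cardV rI NI) _; rewrite cI leq_add2r.
have [x0 x0I] : exists x, x \in I by apply/card_gt0P; rewrite cI.
case: (arg_minnP (fun w => s w) x0I) => v vI minv {x0 x0I}; have {}vI : v \in I by [].
have cD : #|I :\ v| = k.*2 by move: cI; rewrite (cardsD1 v) vI => -[].
have rQ : r \notin (set0 : {set V}) by rewrite in_set0.
have c0 : #|(set0 : {set V})| <= 1 by rewrite cards0.
have al0 al : (set0 : {set V}) != set0 -> al.*2 + 2 <= n by rewrite eqxx.
rewrite (big_setD1 v) //= addnC; apply: leq_add.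
  apply: leq_trans (le_profile par_root depth_par cardV centroid c0 rQ (al0 n) _ cD).
    exact: leq_addr.
  exact/avoidsQD1/avoids0.
have := min_subtree par_root depth_par cardV centroid c0 rQ (al0 n) (avoids0 par n rI) vI minv.
rewrite cards0 cI addn0 -{1}cardV max_card => /(_ isT) le_s.
by apply: le_cut; move: le_s; card_lia.
Qed.

End OddProfile.

(** * Cycles, matchings and distances in trees *)

Definition acyclic (G : sgraph) : Prop := forall C : {set {set G}}, ~ is_cycle C.

Section CycleThrough.
Variable G : sgraph.
Local Notation e := (@sedge G).

Definition avoiding (v : G) : rel G := [rel a b | [&& e a b, a != v & b != v]].

Lemma avoiding_sym v : connect_sym (avoiding v).
Proof.
by apply: sym_connect_sym => a b; rewrite /avoiding /= sedge_sym [(a != v) && _]andbC.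
Qed.

(** A simple path from [u] to [u'] that avoids [v] is closed through [v]. The clause [next c v = u]
    places the edge between [v] and [u] on the cycle, which contradicts uniqueness when that edge is
    known to lie outside [C]. *)
Lemma cycle_through (v u u' : G) :
    e v u -> e v u' -> u != u' -> connect (avoiding v) u u' ->
  exists c, [/\ 3 <= size c, ucycle e c, v \in c & next c v = u].
Proof.
move=> evu evu' ne_u /connectP[p0 ep0 def_u']; move: evu' ne_u; rewrite {u'}def_u'.
case: (shortenP ep0) => p ep up _ {p0 ep0} evl ne_u.
exists [:: v, u & p]; split; rewrite ?mem_head //=; last by rewrite eqxx.
  by case: p ne_u {ep up evl}; rewrite //= eqxx.
have avoids q z : z != v -> path (avoiding v) z q -> v \notin z :: q.
  elim: q z => [|w q IHq] z zv /=; first by rewrite inE eq_sym.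
  by case/andP=> /and3P[_ _ wv] /(IHq _ wv) vq; rewrite inE negb_or eq_sym zv.
have vp : v \notin u :: p by apply: avoids ep; rewrite eq_sym sedge_neq.
rewrite /ucycle cons_uniq vp up /= rcons_path evu sedge_sym evl !andbT.
by apply: sub_path ep => a b /and3P[].
Qed.

End CycleThrough.

Section Matching.
Variable G : sgraph.

Lemma matching_of_fun (S : {set G}) (f : G -> G) :
    (forall v, v \in S -> sedge v (f v)) -> (forall v, v \in S -> f v \notin S) ->
    {in S &, injective f} ->
  #|S| <= matching_number G.
Proof.
move=> ef fS injf; pose g v := [set v; f v].
have inS v w : v \in S -> w \in S -> v \in g w -> v = w.
  by move=> vS wS; rewrite !inE => /orP[/eqP//|/eqP eq_v]; have := fS w wS; rewrite -eq_v vS.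
have injg : {in S &, injective g}.
  by move=> v w vS wS eq_g; apply: inS => //; rewrite -eq_g set21.
rewrite -(card_in_imset injg); apply: leq_bigmax_cond; apply/andP; split.
  by apply/subsetP => _ /imsetP[v vS ->]; apply/imsetP; exists (v, f v); rewrite // inE ef.
apply/trivIsetP => _ _ /imsetP[v vS ->] /imsetP[w wS ->] ne_g.
rewrite -setI_eq0; apply/eqP/setP => x; rewrite in_setI in_set0; apply/negP.
case/andP=> xv xw; case/negP: ne_g; apply/eqP; congr g.
have [xS|nxS] := boolP (x \in S); first by rewrite -(inS x v) // -(inS x w).
move: xv xw; rewrite !inE => /orP[/eqP eq_x|/eqP eq_xv]; first by rewrite eq_x vS in nxS.
case/orP=> [/eqP eq_x|/eqP eq_xw]; first by rewrite eq_x wS in nxS.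
by apply: injf; rewrite // -eq_xv.
Qed.

End Matching.

Section Tree.
Variable T : sgraph.
Hypothesis connT : connected_graph T.
Hypothesis acyclicT : acyclic T.
Local Notation e := (@sedge T).

Section Rooted.
Variable r : T.

(** At the root no neighbour is closer, so the default value makes the root its own parent. *)
Definition parent (v : T) : T := odflt r [pick u | e v u && (dist r u < dist r v)].

Lemma parentP v : v != r -> e v (parent v) /\ dist r (parent v) + 1 = dist r v.
Proof.
move=> ne_v; rewrite /parent; case: pickP => [u /andP[evu lt_u]|none] /=.
  split=> //; have := dist_triangle (connT r u) (connT u v).
  by have := dist_edge evu; rewrite dist_sym //; lia.
have [u euv du] : exists2 u, e u v & dist r u + 1 = dist r v.
  by apply: dist_last_edge => //; rewrite eq_sym.
by have := none u; rewrite sedge_sym euv -du /=; lia.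
Qed.

Lemma parent_edge v : v != r -> e v (parent v).
Proof. by case/parentP. Qed.

Lemma parent_depth v : v != r -> dist r (parent v) < dist r v.
Proof. by case/parentP => _; lia. Qed.

Lemma parent_root : parent r = r.
Proof. by rewrite /parent; case: pickP => //= u; rewrite dist0 ltn0 andbF. Qed.

(** Take [u] to be at most as deep as [v]. If [u] were not the parent of [v], then [u] and
    [parent v] would both climb to the root without meeting [v], and this would close a cycle
    through [v]. *)
Lemma edge_parent u v : e u v -> u = parent v \/ v = parent u.
Proof.
wlog le_uv : u v / dist r u <= dist r v.
  move=> H euv; case: (leqP (dist r u) (dist r v)) => [/H/(_ euv)//|/ltnW/H].
  by rewrite sedge_sym => /(_ euv)[]; [right|left].
move=> euv; left; apply/eqP; apply: contraT => ne_u; exfalso.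
have ne_v : v != r.
  apply/eqP => eq_v; move: le_uv euv; rewrite eq_v dist0 leqn0.
  by move/eqP/(dist_eq0 (connT _ _)) <-; rewrite sedge_irrefl.
have to_root w : w != v -> dist r w <= dist r v -> connect (avoiding v) w r.
  have [k le_k] := ubnP (dist r w); elim: k w le_k => // k IHk w le_k ne_w le_w.
  have [->|ne_wr] := eqVneq w r; first exact: connect0.
  have [ew dw] := parentP ne_wr.
  have ne_p : parent w != v by apply: contraTneq le_w => <-; lia.
  apply: (connect_trans (y := parent w)); last by apply: IHk => //; lia.
  by apply: connect1; rewrite /avoiding /= ew ne_w ne_p.
have [ep dp] := parentP ne_v.
have [||||c [c3 uc _ _]] := @cycle_through _ v u (parent v); rewrite // 1?sedge_sym //.
  apply: (connect_trans (y := r)); first by apply: to_root; rewrite // sedge_neq.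
  by rewrite avoiding_sym; apply: to_root; [rewrite eq_sym sedge_neq | lia].
by apply: (@acyclicT [set [set x; next c x] | x in c]); exists c.
Qed.

Local Notation sub := (subtree parent).

Lemma dist_subtree v w : w \in sub v -> dist v w + dist r v <= dist r w.
Proof.
elim/(parent_ind parent_depth): w => [/(root_in_subtree parent_root)->|w ne_w IH wv].
  by rewrite dist0.
case: (subtree_par wv) => [->|/IH]; first by rewrite dist0.
have [ew <-] := parentP ne_w.
have := dist_triangle (connT v (parent w)) (connT _ w).
by rewrite sedge_sym in ew; have := dist_edge ew; lia.
Qed.

(** Induction that lifts the deeper endpoint [u] to its parent. The subtree of [u] separates [u]
    from [w] but not [parent u] from [w], and every other subtree treats [u] and [parent u]
    alike. *)
Lemma dist_separators u w :
  dist u w <= #|[set v | (v != r) && ((u \in sub v) != (w \in sub v))]|.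
Proof.
have [k] := ubnP (dist r u + dist r w); elim: k u w => // k IHk u w.
wlog le_wu : u w / dist r w <= dist r u.
  move=> H lt_k; case: (leqP (dist r w) (dist r u)) => [le|/ltnW le]; first exact: H.
  rewrite dist_sym //; apply: leq_trans (H w u le _) _; first by rewrite addnC.
  rewrite subset_leq_card //; apply/subsetP => v.
  by rewrite in_set => /andP[nv sep]; rewrite in_set nv eq_sym.
have [-> _|ne_uw le_k] := eqVneq u w; first by rewrite dist0.
have ne_u : u != r.
  apply: contra_neqN ne_uw => /eqP eq_u; move: le_wu; rewrite eq_u dist0 leqn0.
  by move/eqP/(dist_eq0 (connT _ _)).
have [eu du] := parentP ne_u.
rewrite (cardsD1 u) in_set ne_u subtree_refl /=.
have wu : w \notin sub u.
  apply/negP => /(subtree_depth parent_root parent_depth ne_u).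
  by rewrite eq_sym (negbTE ne_uw) /=; lia.
rewrite (negbTE wu) /=.
have := dist_triangle (connT u (parent u)) (connT _ w); have := dist_edge eu.
have := IHk (parent u) w; rewrite -ltnS (leq_trans _ le_k); last by lia.
move=> /(_ isT) le1 le2 le3; apply: leq_trans le3 _; apply: leq_add => //.
apply: leq_trans le1 _; rewrite subset_leq_card //.
apply/subsetP => v; rewrite in_set => /andP[ne_v].
have pu : parent u \notin sub u.
  apply/negP => /(subtree_depth parent_root parent_depth ne_u).
  by rewrite eq_sym (negbTE (sedge_neq eu)) /=; lia.
have [->|ne_vu /=] := eqVneq v u; first by rewrite (negbTE pu) (negbTE wu).
rewrite in_setD1 ne_vu in_set ne_v (_ : (parent u \in sub v) = (u \in sub v)) //.
apply/idP/idP; first exact: subtree_parW.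
by case/subtree_par => // eq_u; rewrite eq_u eqxx in ne_vu.
Qed.

Lemma sum_separated (V : finType) (A : {set V}) n : #|V| = n ->
  \sum_(u : V) \sum_(w : V) ((u \in A) != (w \in A) : nat) = (cut n #|A|).*2.
Proof.
move=> cV; have cAC : #|~: A| = n - #|A| by rewrite cardsCs setCK cV.
rewrite (bigID (mem A)) /= -addnn; congr (_ + _).
  rewrite (eq_bigr (fun=> #|~: A|)) => [|u uA]; first by rewrite sum_nat_const cAC.
  by rewrite -card_reflect_sum; apply: eq_bigr => w _; rewrite uA in_setC; case: (w \in A).
rewrite (eq_bigr (fun=> #|A|)) => [|u uA].
  rewrite (eq_bigl (fun u => u \in ~: A)) => [|u]; last by rewrite in_setC.
  by rewrite sum_nat_const cAC mulnC.
by rewrite -card_reflect_sum; apply: eq_bigr => w _; rewrite (negbTE uA); case: (w \in A).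
Qed.

(** Summing the number of separating subtrees over all pairs and exchanging the sums counts, for
    each [v], the pairs separated by [sub v]. *)
Lemma wiener_le_cuts n : #|T| = n -> wiener T <= \sum_(v | v != r) cut n #|sub v|.
Proof.
move=> cT; rewrite -leq_double (wiener_double connT).
have -> : (\sum_(v | v != r) cut n #|sub v|).*2 =
  \sum_(v | v != r) \sum_u \sum_w ((u \in sub v) != (w \in sub v)).
  rewrite -mul2n big_distrr; apply: eq_bigr => v _.
  by rewrite (sum_separated _ cT) -mul2n.
rewrite [leqRHS]exchange_big; apply: leq_sum => u _.
rewrite [leqRHS]exchange_big; apply: leq_sum => w _.
apply: leq_trans (dist_separators u w) _; rewrite -card_reflect_sum [leqRHS]big_mkcond.
by apply: leq_sum => v _; rewrite in_set; case: (v != r).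
Qed.

End Rooted.

(** The root minimises the total distance. Moving it to a child [d] changes this total by at most
    [n - 2s], with [s] the size of the subtree of [d], so minimality gives [2s <= n]. *)
Lemma exists_centroid n (x : T) : #|T| = n ->
  exists r : T, forall v, v != r -> #|subtree (parent r) v|.*2 <= n.
Proof.
move=> cT; case: (@arg_minnP _ x xpredT (fun r => \sum_w dist r w)) => // r _ min_r.
exists r => v ne_v.
have pD := @parent_depth r; have pR := @parent_root r.
have [d [ne_d pd vd]] := child_subtree pR pD (subtree_root pD v) ne_v.
apply: (@leq_trans #|subtree (parent r) d|.*2).
  by rewrite leq_double subset_leq_card // subtreeS.
have [edr _] := parentP ne_d; rewrite pd in edr.
set A := subtree _ d.
have := min_r d isT; rewrite -(leq_add2r #|A|) => le1.
have le2 : \sum_w dist d w + #|A| <= \sum_w dist r w + #|~: A|.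
  rewrite -!card_reflect_sum -!big_split leq_sum //= => w _; rewrite in_setC.
  have := dist_edge edr; have d1 : dist r d > 0.
    by rewrite lt0n; apply: contra_neqN ne_d => /eqP/(dist_eq0 (connT _ _)).
  case: (boolP (w \in A)) => [/dist_subtree|_]; first by lia.
  by have := dist_triangle (connT d r) (connT r w); lia.
have := leq_trans le1 le2; rewrite leq_add2l (cardsCs (~: A)) setCK cT.
by have := max_card (mem A); rewrite cT; card_lia.
Qed.

Definition branching : {set T} := [set v | 1 < #|[set u | e v u]|].

Lemma branchingP v :
  reflect (exists u w, [/\ e v u, e v w & u != w]) (v \in branching).
Proof.
rewrite inE; apply: (iffP (card_gt1P)).
  by case=> u [w [+ + ne_uw]]; rewrite !inE => evu evw; exists u, w.
by case=> u [w [evu evw ne_uw]]; exists u, w; rewrite !inE.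
Qed.

(** The root has two children [d1] and [d2], and the chosen child of the root is [d2]. The edges to
    chosen children split into two matchings by the colour of their upper end, and the edge from [r]
    to [d1] can be added to one of them. *)
Lemma branching_lt_matching : branching != set0 ->
  #|branching| < (matching_number T).*2.
Proof.
case/set0Pn=> r rB; have /branchingP[d1 [d2 [erd1 erd2 ne_d]]] := rB.
have pD := @parent_depth r; have pR := @parent_root r; pose p := parent r.
have child_of w : e r w -> p w = r.
  move=> erw; case: (edge_parent r erw) => // eq_w.
  by rewrite eq_w pR sedge_irrefl in erw.
pose ch v := if v == r then d2 else odflt v [pick c | e v c && (c != p v)].
have chP v : v \in branching -> [/\ e v (ch v), p (ch v) = v & ch v != r].
  rewrite /ch => vB; have [->|ne_v] := eqVneq v r.
    by rewrite child_of // eq_sym sedge_neq.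
  case: pickP => [c /andP[evc ne_c]|none] /=.
    have ne_cr : c != r.
      apply: contraNneq ne_c => eq_c; case: (edge_parent r evc); last by move=> ->.
      by rewrite eq_c pR => eq_v; rewrite eq_v eqxx in ne_v.
    split=> //; case: (edge_parent r evc) => [->//|eq_c].
    by rewrite -/p eq_c eqxx in ne_c.
  have /branchingP[u [w [evu evw ne_uw]]] := vB.
  have := none u; have := none w; rewrite evu evw /= => /eqP eq_w /eqP eq_u.
  by rewrite eq_w eq_u eqxx in ne_uw.
have odd_parent v : v != r -> odd (dist r v) = ~~ odd (dist r (p v)).
  by move=> /parentP[_ <-]; rewrite addn1.
(* Depth parity, flipped inside the subtree of [d1]. Edges to chosen children still alternate in
   colour, since none of them enters that subtree from outside, while [r] and [d1] now have equal
   colour. Hence the edge between them avoids both ends of the edges that start in the other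
   class. *)
pose col v := odd (dist r v) (+) (v \in subtree p d1).
have ne_d1 : d1 != r by rewrite eq_sym sedge_neq.
have col_r : col r = false.
  by rewrite /col dist0 (negbTE (root_notin_subtree pR ne_d1)).
have col_d1 : col d1 = false.
  by rewrite /col odd_parent // -/p child_of // dist0 subtree_refl.
have ch_d1 v : v \in branching -> ch v != d1.
  move=> vB; apply: contraNneq ne_d => eq_ch; have [_ pch _] := chP v vB.
  have eq_v : v = r by rewrite -pch eq_ch child_of.
  by move: eq_ch; rewrite eq_v /ch eqxx => ->.
have col_ch v : v \in branching -> col (ch v) = ~~ col v.
  move=> vB; have [_ pch ne_ch] := chP v vB; rewrite /col odd_parent // -/p pch addNb.
  congr (~~ (_ (+) _)); apply/idP/idP => [/subtree_par[eq_ch|]|].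
  - by have := ch_d1 v vB; rewrite eq_ch eqxx.
  - by rewrite pch.
  by rewrite -{1}pch; apply: subtree_parW.
have inj_ch v w : v \in branching -> w \in branching -> ch v = ch w -> v = w.
  by move=> /chP[_ pv _] /chP[_ pw _] eq_ch; rewrite -pv -pw eq_ch.
pose S b := [set v in branching | col v == b].
have le0 : #|S false| <= matching_number T.
  apply: (@matching_of_fun _ _ ch) => [v|v|v w].
  - by case/setIdP=> /chP[].
  - by case/setIdP=> vB /eqP cv; rewrite in_set col_ch // cv andbF.
  - by case/setIdP=> vB _ /setIdP[wB _]; apply: inj_ch.
have le1 : #|r |: S true| <= matching_number T.
  apply: (@matching_of_fun _ _ (fun v => if v == r then d1 else ch v)) => [v|v|v w].
  - case: eqP => [->//|ne_v]; rewrite in_setU1 => /predU1P[//|].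
    by case/setIdP=> /chP[].
  - case: eqP => [_ _|ne_v]; first by rewrite in_setU1 negb_or ne_d1 in_set col_d1 andbF.
    rewrite in_setU1 => /predU1P[//|/setIdP[vB /eqP cv]].
    have [_ _ ne_ch] := chP v vB.
    by rewrite in_setU1 negb_or ne_ch in_set col_ch // cv andbF.
  - rewrite !in_setU1; case: eqP => [-> _|ne_v]; case: eqP => [->//|ne_w] //=.
    + by case/setIdP=> wB _ eq_ch; have := ch_d1 w wB; rewrite -eq_ch eqxx.
    + by case/setIdP=> vB _ _ eq_ch; have := ch_d1 v vB; rewrite eq_ch eqxx.
    + by case/setIdP=> vB _ /setIdP[wB _]; apply: inj_ch.
have : #|branching| = #|S false| + #|S true|.
  rewrite -card_disjointU; last first.
    by rewrite -setI_eq0; apply/eqP/setP => v; rewrite !in_set; case: (col v); rewrite !andbF.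
  by apply: eq_card => v; rewrite in_setU !in_set -andb_orr; case: (col v); rewrite andbT.
move: le1; rewrite cardsU1 in_set col_r andbF; move: le0; card_lia.
Qed.

Lemma nonroot_branching r v : v != r -> 1 < #|subtree (parent r) v| -> v \in branching.
Proof.
move=> ne_v s1; have pD := @parent_depth r; have pR := @parent_root r.
have /card_gt1P[u [w [us ws ne_uw]]] := s1.
have [x xs ne_x] : exists2 x, x \in subtree (parent r) v & x != v.
  have [eq_u|ne_u] := eqVneq u v; last by exists u.
  by exists w => //; rewrite eq_sym -eq_u.
have [c [ne_c pc _]] := child_subtree pR pD xs ne_x.
have [ev dv] := parentP ne_v; have [ec dc] := parentP ne_c.
apply/branchingP; exists (parent r v), c; split=> //.
  by rewrite sedge_sym; move: ec; rewrite pc.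
by apply/eqP => eq_c; move: dv dc; rewrite eq_c pc; lia.
Qed.

(** One child subtree has at most [n / 2] vertices, so for [n > 2] it does not exhaust the non-root
    vertices and there is a second child. *)
Lemma centroid_branching r n : #|T| = n -> 2 < n ->
  (forall v, v != r -> #|subtree (parent r) v|.*2 <= n) -> r \in branching.
Proof.
move=> cT n2 cen; have pD := @parent_depth r; have pR := @parent_root r.
have other (A : {set T}) : r \in A -> #|A| < n -> exists2 x, x != r & x \notin A.
  move=> rA ltA; have /card_gt0P[x] : 0 < #|~: A| by rewrite cardsCs setCK cT subn_gt0.
  by rewrite in_setC => xA; exists x => //; apply: contraNneq xA => ->.
have [||x ne_x _] := other [set r]; rewrite ?set11 ?cards1 //; first by lia.
have [c [ne_c pc xc]] := child_subtree pR pD (subtree_root pD x) ne_x.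
have [||y ne_y] := other (r |: subtree (parent r) c); first exact: setU11.
  have := cen c ne_c; rewrite cardsU1 (root_notin_subtree pR ne_c).
  by move: n2; card_lia.
rewrite in_setU1 negb_or => /andP[_ yc].
have [c' [ne_c' pc' yc']] := child_subtree pR pD (subtree_root pD y) ne_y.
apply/branchingP; exists c, c'; split.
- by rewrite sedge_sym; move: (parent_edge ne_c); rewrite pc.
- by rewrite sedge_sym; move: (parent_edge ne_c'); rewrite pc'.
- by apply: contraNneq yc => ->.
Qed.

End Tree.

(** * Unicyclic graphs *)

Section DeleteEdges.
Variables (G : sgraph) (D : {set {set G}}).

Definition del_rel : rel G := [rel x y | sedge x y && ([set x; y] \notin D)].

Lemma del_sym : symmetric del_rel.
Proof. by move=> x y; rewrite /del_rel /= sedge_sym setUC. Qed.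

Lemma del_irrefl : irreflexive del_rel.
Proof. by move=> x; rewrite /del_rel /= sedge_irrefl. Qed.

Definition del_edges : sgraph := SGraph del_sym del_irrefl.

Lemma del_edgeE x y : @sedge del_edges x y = @sedge G x y && ([set x; y] \notin D).
Proof. by []. Qed.

Lemma sub_del_edges : subrel (@sedge del_edges) (@sedge G).
Proof. by move=> x y /andP[]. Qed.

Lemma dist_del_edges x y : connect (@sedge del_edges) x y ->
  @dist G x y <= @dist del_edges x y.
Proof.
case/dist_walk=> p [ep lp <-]; apply: (@dist_le G x y p _ lp).
exact: sub_path sub_del_edges _ _ ep.
Qed.

Lemma matching_number_del : matching_number del_edges <= matching_number G.
Proof.
apply/bigmax_leqP => M /andP[sM tM].
apply: (@leq_bigmax_cond _ _ (fun M : {set {set G}} => #|M|)).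
rewrite /is_matching tM andbT; apply: subset_trans sM _.
apply/subsetP => _ /imsetP[p + ->]; rewrite inE => /andP[ep _].
by apply/imsetP; exists p; rewrite ?inE.
Qed.

Lemma is_cycle_del (C : {set {set G}}) : @is_cycle del_edges C ->
  is_cycle C /\ [disjoint C & D].
Proof.
case=> c [c3 uc ->]; split.
  exists c; split=> //; case/andP: uc => cyc uniq_c; apply/andP; split=> //.
  refine (@sub_cycle (svertex G) (@sedge del_edges) (@sedge G) sub_del_edges c cyc).
rewrite disjoint_subset; apply/subsetP => _ /imsetP[x xc ->]; rewrite inE.
by case/andP: uc => cyc _; have /andP[] := next_cycle cyc xc.
Qed.

End DeleteEdges.

Section Unicyclic.
Variable G : sgraph.
Hypothesis connG : connected_graph G.
Variable C : {set {set G}}.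
Hypothesis uniqC : forall C' : {set {set G}}, is_cycle C' -> C' = C.
Local Notation e := (@sedge G).

Definition traces (c : seq G) : Prop :=
  [/\ 3 <= size c, ucycle e c & C = [set [set x; next c x] | x in c]].

Lemma traces_rot c k : traces c -> traces (rot k c).
Proof.
case=> c3 uc defC; split; rewrite ?size_rot ?rot_ucycle //.
rewrite defC; case/andP: uc => _ uc; apply/setP => E.
apply/imsetP/imsetP => -[x xc ->]; exists x; rewrite ?next_rot ?mem_rot //.
by rewrite mem_rot in xc.
Qed.

Local Notation F := (del_edges C).

(** The branch at a cycle vertex is its component once all edges of [C] are deleted. Uniqueness of
    the cycle makes [base] well determined: each component contains exactly one cycle vertex. *)
Definition base (v : G) : G :=
  odflt v [pick x | (x \in cover C) && connect (@sedge F) v x].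

Definition height (v : G) : nat := @dist F v (base v).

Definition weight (x : G) : nat := #|[set v | base v == x]|.

Section Traced.
Variables (x0 : G) (p : seq G).
Local Notation c := (x0 :: p).
Hypothesis tr : traces c.

Let uniq_c : uniq c. Proof. by case: tr => _ /andP[]. Qed.
Let cyc_c : cycle e c. Proof. by case: tr => _ /andP[]. Qed.
Let defC : C = [set [set x; next c x] | x in c]. Proof. by case: tr. Qed.
Let size_p : 1 < size p. Proof. by case: tr. Qed.

Lemma cover_traced : cover C =i c.
Proof.
move=> x; rewrite /cover; apply/bigcupP/idP => [[E]|xc].
  by rewrite defC => /imsetP[y yc ->] /set2P[]->; rewrite ?mem_next.
by exists [set x; next c x]; rewrite ?set21 // defC; apply: imset_f.
Qed.

Lemma not_cover_edge a b : e a b -> a \notin c -> @sedge F a b.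
Proof.
move=> eab; rewrite del_edgeE eab -cover_traced; apply: contra => abC.
by apply/bigcupP; exists [set a; b]; rewrite ?set21.
Qed.

Lemma connect_cycle v : exists2 x, x \in c & connect (@sedge F) v x.
Proof.
have /connectP[q eq ->] := connG x0 v.
elim/last_ind: q eq => [_|q z IHq] /=; first by exists x0; rewrite ?mem_head ?connect0.
rewrite rcons_path last_rcons => /andP[/IHq[x xc cx] ez].
have [zc|zc] := boolP (z \in c); first by exists z; rewrite ?connect0.
exists x => //; apply: connect_trans cx; apply: connect1.
by apply: not_cover_edge; rewrite // sedge_sym.
Qed.

(** A path off [C] from [x] to a different cycle vertex [y] starts with an edge to some [z].
    Returning from [y] along the cycle to the successor [u] of [x] gives a cycle through the edge
    between [x] and [z], which is not in [C]. *)
Lemma cycle_separated x y : x \in c -> y \in c -> connect (@sedge F) x y -> x = y.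
Proof.
move=> xc yc /connectP[q0 eq0]; case: (shortenP eq0) => q eq uq _ {q0 eq0} def_y.
apply/eqP; apply: contraT => ne_xy.
case: q eq uq def_y => [|z q] /=; first by move=> _ _ eq_y; rewrite eq_y eqxx in ne_xy.
case/andP=> /andP[exz xzC] eq /andP[xq _] def_y.
have avoid_path (r : rel G) a s : subrel r e -> path r a s -> x \notin a :: s ->
    path (avoiding x) a s.
  move=> sub_r; elim: s a => //= b s IHs a /andP[rab rs].
  rewrite inE negb_or => /andP[xa xs]; rewrite (IHs _ rs xs) andbT.
  rewrite /avoiding /= (sub_r _ _ rab) eq_sym xa /=.
  by rewrite inE negb_or in xs; case/andP: xs; rewrite eq_sym.
have czy : connect (avoiding x) z y.
  apply/connectP; exists q => //; apply: avoid_path eq xq.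
  exact: sub_del_edges.
have [i s def_s] := rot_to xc.
have := traces_rot i tr; rewrite def_s => -[s3 /andP[cyc_s uniq_s] defC'].
have ys : y \in s.
  by move: yc; rewrite -(mem_rot i) def_s inE eq_sym (negbTE ne_xy).
case: s s3 cyc_s uniq_s defC' ys {def_s} => // u s _ /= /andP[exu eus] /andP[xs _] defC' ys.
have xuC : [set x; u] \in C.
  by rewrite defC'; apply/imsetP; exists x; rewrite ?mem_head //= eqxx.
have cuy : connect (avoiding x) u y.
  apply: path_connect ys; apply: (avoid_path e) xs => [//|].
  by move: eus; rewrite rcons_path => /andP[].
have ne_zu : z != u by apply: contraNneq xzC => ->.
have [|c2 [c23 uc2 xc2 nx]] := cycle_through exz exu ne_zu.
  by apply: connect_trans czy _; rewrite avoiding_sym.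
case/negP: xzC; rewrite -(@uniqC [set [set t; next c2 t] | t in c2]); last by exists c2.
by apply/imsetP; exists x; rewrite ?nx.
Qed.

Lemma baseP v : base v \in c /\ connect (@sedge F) v (base v).
Proof.
rewrite /base; case: pickP => [x /andP[xC cx]|none] /=; first by rewrite -cover_traced.
by have [x xc cx] := connect_cycle v; have := none x; rewrite cover_traced xc cx.
Qed.

Lemma base_cycle v : base v \in c. Proof. by case: (baseP v). Qed.

Lemma base_connect u v : connect (@sedge F) u v -> base u = base v.
Proof.
move=> cuv; have [uc cu] := baseP u; have [vc cv] := baseP v.
apply: cycle_separated => //; apply: connect_trans (connect_trans cuv cv).
by rewrite connect_sedge_sym.
Qed.

Lemma base_id x : x \in c -> base x = x.
Proof.
by move=> xc; have [yc cy] := baseP x; apply: esym; apply: cycle_separated.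
Qed.

Lemma height_cycle x : x \in c -> height x = 0.
Proof. by move=> xc; rewrite /height base_id // dist0. Qed.

Lemma height_lipschitz a b : @sedge F a b -> height b <= height a + 1.
Proof.
move=> eab; have [_ ca] := baseP a; have eba : @sedge F b a by rewrite sedge_sym.
rewrite /height -(base_connect (connect1 eab)).
by have := dist_triangle (connect1 eba) ca; have := dist_edge eba; lia.
Qed.

Lemma weight_sum : \sum_(x <- c) weight x = #|G|.
Proof.
rewrite big_uniq //= -sum1_card [RHS](partition_big base (fun x => x \in c)) /=.
  by apply: eq_bigr => x _; rewrite /weight -sum1dep_card.
by move=> v _; apply: base_cycle.
Qed.

Lemma weight_gt0 x : x \in c -> 0 < weight x.
Proof. by move=> xc; apply/card_gt0P; exists x; rewrite inE base_id. Qed.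

Lemma edge_in_cycle a b : [set a; b] \in C ->
  [/\ a \in c, b \in c & b = next c a \/ a = next c b].
Proof.
move=> abC; have sub_c : {subset [set a; b] <= c}.
  by move=> z zab; rewrite -cover_traced; apply/bigcupP; exists [set a; b].
split; rewrite ?sub_c ?set21 ?set22 //.
move: abC; rewrite defC => /imsetP[x xc eq_ab].
have : x \in [set a; b] by rewrite eq_ab set21.
have : next c x \in [set a; b] by rewrite eq_ab set22.
have ne_x : x != next c x by apply: sedge_neq; apply: next_cycle.
case/set2P=> eq_n /set2P[] eq_x.
- by rewrite eq_n eq_x eqxx in ne_x.
- by right; rewrite -eq_x eq_n.
- by left; rewrite -eq_x eq_n.
- by rewrite eq_n eq_x eqxx in ne_x.
Qed.

(** [traces] is stable under rotation, so opening at this fixed place gives access to every edge of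
    the cycle. *)
Definition closing : {set G} := [set last x0 p; x0].

Definition opened : sgraph := del_edges [set closing].
Local Notation T := opened.

Lemma openedE a b : @sedge T a b = e a b && ([set a; b] != closing).
Proof. by rewrite del_edgeE inE. Qed.

Lemma next_index x : x \in c -> [set x; next c x] != closing ->
  index (next c x) c = index x c + 1.
Proof.
move=> xc; rewrite next_nth xc; have := xc; rewrite -index_mem [size c]/= ltnS leq_eqVlt.
case/orP=> [/eqP eq_i|lt_i].
  have -> : x = last x0 p by rewrite (last_nth x0) -eq_i nth_index.
  by rewrite index_last // nth_default // eqxx.
by rewrite addn1 -[nth _ p _]/(nth x0 c (index x c).+1) index_uniq.
Qed.

Lemma closing_edge : closing \in C.
Proof.
rewrite defC; apply/imsetP; exists (last x0 p); first exact: mem_last.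
by rewrite next_nth mem_last index_last // nth_default.
Qed.

Lemma sub_F_T : subrel (@sedge F) (@sedge T).
Proof.
move=> a b; rewrite openedE del_edgeE => /andP[-> abC] /=.
by apply: contraNneq abC => ->; exact: closing_edge.
Qed.

Lemma acyclic_opened : acyclic T.
Proof.
move=> C' /is_cycle_del[/uniqC ->]; rewrite disjoint_sym => /pred0P/(_ closing).
by rewrite /= inE eqxx closing_edge.
Qed.

Lemma opened_step i : i < size p -> @sedge T (nth x0 c i) (nth x0 c i.+1).
Proof.
move=> lt_i; rewrite openedE.
have lt_c : i < size c by rewrite ltnW.
have ei : nth x0 c i.+1 = next c (nth x0 c i).
  by rewrite next_nth mem_nth // index_uniq.
rewrite {1}ei next_cycle ?mem_nth //=.
have -> : closing = [set nth x0 c (size p); nth x0 c 0] by rewrite /closing (last_nth x0).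
apply/eqP => eq_s.
have : nth x0 c i.+1 \in [set nth x0 c (size p); nth x0 c 0] by rewrite -eq_s set22.
have : nth x0 c i \in [set nth x0 c (size p); nth x0 c 0] by rewrite -eq_s set21.
by rewrite !in_set2 !nth_uniq //; move: size_p lt_i; case: i {lt_c ei eq_s} => [|i]; lia.
Qed.

Lemma dist_along (H : sgraph) (f : nat -> H) k i j : i <= j -> j <= k ->
  (forall l, l < k -> sedge (f l) (f l.+1)) ->
  dist (f i) (f j) <= j - i /\ connect (@sedge H) (f i) (f j).
Proof.
move=> le_ij + step; elim: j le_ij => [|j IHj].
  by rewrite leqn0 => /eqP-> _; rewrite dist0 connect0.
rewrite leq_eqVlt => /orP[/eqP->|le_ij] lt_j; first by rewrite dist0 connect0.
have [le_d cij] := IHj le_ij (ltnW lt_j); have ej := step j lt_j.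
have cj := connect1 ej; split; last exact: connect_trans cij cj.
by have := dist_triangle cij cj; have := dist_edge ej; lia.
Qed.

Lemma connected_opened : connected_graph T.
Proof.
have to0 v : connect (@sedge T) x0 v.
  have [vc cv] := baseP v.
  have le_v : index (base v) c <= size p by rewrite -ltnS index_mem.
  have [_ c0] := @dist_along T (nth x0 c) _ _ _ (leq0n _) le_v opened_step.
  rewrite nth_index // in c0; apply: connect_trans c0 _.
  rewrite connect_sedge_sym; apply: connect_sub cv => a b /sub_F_T; exact: connect1.
by move=> u v; apply: connect_trans (to0 v); rewrite connect_sedge_sym.
Qed.

Definition pos v := index (base v) c.

Definition gap (i j : nat) := i - j + (j - i).

Lemma dist_opened_ge u v : pos u != pos v ->
  height u + gap (pos u) (pos v) + height v <= @dist T u v.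
Proof.
(* [phi] vanishes at [u] and is 1-Lipschitz on the opened tree: an edge off [C] stays in its branch,
   and a remaining edge of [C] joins consecutive positions at height 0. In the branch of [u] a
   truncated difference of heights suffices, and it agrees with the other clause at the cycle
   vertex. *)
move=> ne_uv; pose phi w := if base w == base u then height u - height w
                            else height u + gap (pos u) (pos w) + height w.
have lip : forall a b, @sedge T a b -> phi b <= phi a + 1.
  move=> a b; rewrite openedE => /andP[eab ne_cl].
  have [abC|abC] := boolP ([set a; b] \in C); last first.
    have eF : @sedge F a b by rewrite del_edgeE eab.
    have eF' : @sedge F b a by rewrite sedge_sym.
    have := height_lipschitz eF; have := height_lipschitz eF'.
    rewrite /phi /pos (base_connect (connect1 eF)); case: ifP => _; lia.
  have [ac bc nxt] := edge_in_cycle abC.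
  have step : (pos b = pos a + 1) \/ (pos a = pos b + 1).
    rewrite /pos !base_id //; case: nxt => eq_n; [left|right].
      by rewrite {1}eq_n next_index // -eq_n.
    by rewrite {1}eq_n next_index // -eq_n setUC.
  have pos_base w w' : base w = base w' -> pos w = pos w' by rewrite /pos => ->.
  rewrite /phi /gap (height_cycle ac) (height_cycle bc).
  by do 2 case: eqP => [/pos_base|_]; move: step; lia.
have := @dist_lipschitz T phi u v lip (connected_opened u v).
rewrite {1 2}/phi eqxx subnn add0n ifN //.
by apply: contra ne_uv => /eqP eq_b; rewrite /pos eq_b.
Qed.

Lemma dist_cycle_le i j : i <= j -> j <= size p ->
  @dist G (nth x0 c i) (nth x0 c j) <= size c - (j - i).
Proof.
move=> le_ij le_j; have stepG l : l < size p -> e (nth x0 c l) (nth x0 c l.+1).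
  by move=> /opened_step; apply: sub_del_edges.
have [d0 _] := @dist_along G (nth x0 c) (size p) 0 i (leq0n _) (leq_trans le_ij le_j) stepG.
have [dj _] := @dist_along G (nth x0 c) (size p) j (size p) le_j (leqnn _) stepG.
have d1 : @dist G (nth x0 c 0) (nth x0 c (size p)) <= 1.
  rewrite [nth _ _ (size p)](_ : _ = last x0 p) /=; last by rewrite (last_nth x0).
  by apply: dist_edge; move: cyc_c; rewrite /= rcons_path sedge_sym => /andP[].
have d2 := dist_triangle (connG (nth x0 c i) (nth x0 c 0)) (connG _ (nth x0 c j)).
have d3 := dist_triangle (connG (nth x0 c 0) (nth x0 c (size p))) (connG _ (nth x0 c j)).
rewrite (dist_sym (connG (nth x0 c i) (nth x0 c 0))) in d2.
rewrite (dist_sym (connG (nth x0 c (size p)) (nth x0 c j))) in d3.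
by move: d0 d1 d2 d3 dj le_ij le_j; rewrite [size c]/=; clear; lia.
Qed.

(** The opened tree forces a walk of [gap] cycle edges, whereas in [G] the way through the closing
    edge has [g - gap] of them. The saving is [2 gap - g] when this is positive, and truncated
    subtraction covers the other case. *)
Lemma dist_loss u v :
  @dist G u v + ((gap (pos u) (pos v)).*2 - size c) <= @dist T u v.
Proof.
wlog le_uv : u v / pos u <= pos v.
  move=> H; case: (leqP (pos u) (pos v)) => [/H//|/ltnW/H].
  rewrite (dist_sym (connG v u)) (dist_sym (connected_opened v u)).
  by rewrite /gap addnC [pos v - _ + _]addnC addnC.
have le_G : @dist G u v <= @dist T u v by apply: dist_del_edges; apply: connected_opened.
have [small|big] := leqP (gap (pos u) (pos v)).*2 (size c).
  by move: small; rewrite -subn_eq0 => /eqP->; rewrite addn0.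
have ne_uv : pos u != pos v.
  by apply: contraTneq big => ->; rewrite /gap subnn.
have ge_T := dist_opened_ge ne_uv.
have le_pv : pos v <= size p by rewrite -ltnS index_mem base_cycle.
have le_c := dist_cycle_le le_uv le_pv.
rewrite !nth_index ?base_cycle // in le_c.
have to_base w : @dist G w (base w) <= height w.
  by apply: dist_del_edges; case: (baseP w).
have d1 := dist_triangle (connG u (base u)) (connG _ v).
have d2 := dist_triangle (connG (base u) (base v)) (connG _ v).
rewrite (dist_sym (connG (base v) v)) in d2.
move: ge_T le_c big d1 d2 (to_base u) (to_base v) le_uv le_pv; rewrite /gap /pos [size c]/=.
by clear; lia.
Qed.

Lemma wiener_loss :
  (wiener G).*2 + \sum_(u : G) \sum_(v : G) ((gap (pos u) (pos v)).*2 - size c)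
    <= (wiener T).*2.
Proof.
rewrite (wiener_double connG) (wiener_double connected_opened) -big_split.
apply: leq_sum => u _; rewrite -big_split; apply: leq_sum => v _.
exact: dist_loss.
Qed.

End Traced.
End Unicyclic.

Section Loss.
Variables (G : sgraph) (C : {set {set G}}).
Hypothesis connG : connected_graph G.
Hypothesis uniqC : forall C' : {set {set G}}, is_cycle C' -> C' = C.
Variables (x0 : G) (p : seq G).
Hypothesis tr : traces C (x0 :: p).
Local Notation c := (x0 :: p).
Local Notation g := (size c).
Local Notation w i := (weight C (nth x0 c i)).

Lemma card_pos i : i < g -> #|[set v | pos C x0 p v == i]| = w i.
Proof.
move=> lt_i; rewrite /weight; apply: eq_card => v; rewrite !inE /pos.
have bc := base_cycle connG tr v; have [_ /andP[_ uc] _] := tr.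
apply/eqP/eqP => [<-|->]; first by rewrite nth_index.
by rewrite index_uniq.
Qed.

Lemma sum_indicator (V : finType) (A B : {set V}) :
  \sum_(u : V) \sum_(v : V) (u \in A) * (v \in B) = #|A| * #|B|.
Proof.
rewrite -!card_reflect_sum big_distrl; apply: eq_bigr => u _.
by rewrite big_distrr.
Qed.

(** Only the pairs of branches [g - 1] or [g - 2] positions apart are counted, with losses [g - 2]
    and [g - 4]. For [g = 3] and [g = 4] the second coefficient is zero. *)
Lemma wiener_open_cycle :
  wiener G + ((g - 2) * (w 0 * w (g - 1)) +
              (g - 4) * (w 0 * w (g - 2) + w 1 * w (g - 1)))
    <= wiener (opened x0 p).
Proof.
have [g3 _ _] := tr.
rewrite -leq_double; apply: leq_trans (wiener_loss connG uniqC tr).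
rewrite doubleD leq_add2l; pose A i := [set v | pos C x0 p v == i].
have -> : ((g - 2) * (w 0 * w (g - 1)) +
              (g - 4) * (w 0 * w (g - 2) + w 1 * w (g - 1))).*2 =
  \sum_(u : G) \sum_(v : G)
   ((g - 2) * ((u \in A 0) * (v \in A (g - 1)) + (u \in A (g - 1)) * (v \in A 0)) +
    (g - 4) * ((u \in A 0) * (v \in A (g - 2)) + (u \in A (g - 2)) * (v \in A 0) +
     ((u \in A 1) * (v \in A (g - 1)) + (u \in A (g - 1)) * (v \in A 1)))).
  have cA i : i < g -> #|A i| = w i by exact: card_pos.
  have split4 (V : finType) (f1 f2 f3 f4 f5 f6 : V -> V -> nat) a b :
    \sum_u \sum_v (a * (f1 u v + f2 u v) + b * (f3 u v + f4 u v + (f5 u v + f6 u v))) =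
    a * (\sum_u \sum_v f1 u v + \sum_u \sum_v f2 u v) +
    b * (\sum_u \sum_v f3 u v + \sum_u \sum_v f4 u v +
     (\sum_u \sum_v f5 u v + \sum_u \sum_v f6 u v)).
    rewrite -!big_split !big_distrr -big_split; apply: eq_bigr => u _ /=.
    by rewrite -!big_split !big_distrr -big_split.
  by rewrite split4 !sum_indicator !cA; lia.
apply: leq_sum => u _; apply: leq_sum => v _; rewrite !in_set.
have pos_lt x : pos C x0 p x < g by rewrite index_mem (base_cycle connG tr).
have := pos_lt u; have := pos_lt v; rewrite /gap.
move: (pos C x0 p u) (pos C x0 p v) (size c) g3 => i j s s3 lt_j lt_i.
clear -s3 lt_j lt_i.
by do 8 case: eqP => ?; rewrite ?muln0 ?muln1 ?addn0 ?add0n; lia.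
Qed.

End Loss.

(* The Wiener index of a path on 2k + 1 vertices with n - 2k - 1 leaves spread evenly over
   its two ends. *)
Definition tree_bound (n k : nat) : nat :=
  \sum_(j < k) balanced_cuts n (n - j.*2.+1) + (n - k.*2.+1) * (n - 1).

(** * Upper bounds for the Wiener index of a tree *)

Section TreeBounds.
Variable T : sgraph.
Hypothesis connT : connected_graph T.
Hypothesis acyclicT : acyclic T.
Local Notation e := (@sedge T).
Variable n : nat.
Hypothesis cardT : #|T| = n.
Hypothesis n_gt2 : 2 < n.

Lemma card_nonroot_branching r : r \in branching T ->
  #|[set v | (v != r) && (1 < #|subtree (parent r) v|)]| < #|branching T|.
Proof.
move=> rB; rewrite (cardsD1 r (branching T)) rB add1n ltnS subset_leq_card //.
apply/subsetP => v; rewrite in_set => /andP[ne_v s1].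
by rewrite in_setD1 ne_v /=; apply: nonroot_branching s1.
Qed.

Lemma branching_centroid : exists r, [/\ r \in branching T,
    #|[set v | (v != r) && (1 < #|subtree (parent r) v|)]| < #|branching T| &
    forall v, v != r -> #|subtree (parent r) v|.*2 <= n].
Proof.
have [x _] : exists x, x \in T by apply/card_gt0P; rewrite cardT; lia.
have [r cen] := exists_centroid connT x cardT.
have rB := centroid_branching connT cardT n_gt2 cen.
by exists r; split=> //; apply: card_nonroot_branching.
Qed.

Lemma wiener_tree k : #|branching T| <= k.*2.+1 -> k.*2 < n ->
  wiener T <= tree_bound n k.
Proof.
move=> leB lt_k; have [r [rB lt_N cen]] := branching_centroid.
apply: leq_trans (wiener_le_cuts connT r cardT) _.
have pR := @parent_root T r; have pD := @parent_depth _ connT r.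
have c0 : #|(set0 : {set T})| <= 1 by rewrite cards0.
have rQ : r \notin (set0 : {set T}) by rewrite in_set0.
have al0 al : (set0 : {set T}) != set0 -> al.*2 + 2 <= n by rewrite eqxx.
have := le_cut_sum pR pD cardT cen c0 rQ (al0 n) (leq_trans lt_N leB).
rewrite cards0 addn0 => /(_ _ lt_k) H; apply: leq_trans (H _); first exact: leq_addr.
by apply: avoids0; rewrite in_set eqxx.
Qed.

Lemma wiener_tree_odd k : #|branching T| <= k.*2.+2 -> k.*2.+1 < n ->
  wiener T <= \sum_(j < k) balanced_cuts n (n - j.*2.+1) + cut n (n - k.*2)./2
                + (n - k.*2.+2) * (n - 1).
Proof.
move=> leB lt_k; have [r [rB lt_N cen]] := branching_centroid.
apply: leq_trans (wiener_le_cuts connT r cardT) _.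
apply: (le_cut_sum_odd (@parent_root T r) (@parent_depth _ connT r) cardT cen _ lt_k).
exact: leq_trans lt_N leB.
Qed.

(** [x] is the only gate of [A]: the parent sequence of a vertex of [A] has to pass through it on
    its way to a root outside. *)
Lemma subtree_exit r x (A : {set T}) : r \notin A ->
    (forall w z, e w z -> w \in A -> z \notin A -> w = x) ->
  A \subset subtree (parent r) x.
Proof.
move=> rA exitA; apply/subsetP => w.
elim/(parent_ind (@parent_depth _ connT r)): w => [|w ne_w IH wA].
  by rewrite (negbTE rA).
have [pA|pA] := boolP (parent r w \in A); first exact/subtree_parW/IH.
by rewrite (exitA _ _ (parent_edge connT ne_w) wA pA) subtree_refl.
Qed.

Lemma subtree_enter r x (A : {set T}) : r \in A -> r != x ->
    (forall w z, e w z -> w \in A -> z \notin A -> w = x) ->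
  ~: A \subset subtree (parent r) x.
Proof.
move=> rA ne_rx exitA; apply/subsetP => w.
elim/(parent_ind (@parent_depth _ connT r)): w => [|w ne_w IH].
  by rewrite in_setC rA.
rewrite in_setC => wA; have [pA|pA] := boolP (parent r w \in A).
  have ew := parent_edge connT ne_w; rewrite sedge_sym in ew.
  by apply: subtree_parW; rewrite (exitA _ _ ew pA wA) subtree_refl.
by apply/subtree_parW/IH; rewrite in_setC.
Qed.

(** The leaf [q] is the exceptional vertex. A non-leaf subtree containing [q] contains its neighbour
    [x], hence all of [B] or all of its complement, according to the side of the root. Both have
    more than [al] vertices because [2 al + 2 <= n]. *)
Lemma wiener_tree_leaf (q x : T) (B : {set T}) al k :
    e q x -> (forall z, e q z -> z = x) -> x \in B -> q \in B ->
    (forall w z, e w z -> w \in B -> z \notin B -> w = x) ->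
    #|B| = al.+1 -> al.*2 + 2 <= n -> #|branching T| <= k.*2.+1 -> k.*2.+1 < n ->
  wiener T + \sum_(j < k) (if n - j.*2.+1 <= al.*2 then 2 else 0) <= tree_bound n k.
Proof.
move=> eqx leaf_q xB qB exitB cB le_al leB lt_k.
have [r [rB lt_N cen]] := branching_centroid.
have q_leaf : q \notin branching T.
  apply/negP => /branchingP[u [w [/leaf_q-> /leaf_q->]]]; by rewrite eqxx.
have pR := @parent_root T r; have pD := @parent_depth _ connT r.
have ne_rq : r != q by apply: contraNneq q_leaf => <-.
have c1 : #|[set q]| <= 1 by rewrite cards1.
have rQ : r \notin [set q] by rewrite in_set1.
have avoidN : avoidsQ r (parent r) [set q] al
    [set v | (v != r) && (1 < #|subtree (parent r) v|)].
  split; first by rewrite in_set eqxx.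
    rewrite disjoint_sym disjoints1 in_set negb_and.
    apply/orP; right; apply: contra q_leaf => s1.
    by apply: nonroot_branching s1; rewrite // eq_sym.
  move=> v z; rewrite in_set => /andP[ne_v s1] /set1P-> qv.
  have ne_qv : q != v.
    by apply: contraNneq q_leaf => ->; apply: nonroot_branching s1.
  have xv : x \in subtree (parent r) v.
    case: (subtree_par qv) => [eq_qv|]; first by rewrite eq_qv eqxx in ne_qv.
    by rewrite (leaf_q (parent r q)) //; apply: parent_edge; rewrite // eq_sym.
  have ne_rx : r != x.
    apply: contraNneq (root_notin_subtree pR ne_v) => eq_rx.
    by rewrite [X in X \in _]eq_rx.
  apply: leq_trans (subset_leq_card (subtreeS xv)).
  have [rB'|rB'] := boolP (r \in B); last first.
    by rewrite -cB; apply: subset_leq_card; apply: subtree_exit.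
  apply: leq_trans (subset_leq_card (subtree_enter rB' ne_rx exitB)).
  by rewrite cardsCs setCK cB cardT; move: le_al; clear; lia.
have := le_cut_sum pR pD cardT cen c1 rQ (fun=> le_al) (leq_trans lt_N leB) avoidN.
rewrite cards1 addn1 => /(_ lt_k) H.
apply: leq_trans H; apply: leq_add; first exact: wiener_le_cuts.
apply: leq_sum => j _; rewrite /saving.
by have -> : [set q] != set0 by apply/set0Pn; exists q; rewrite set11.
Qed.

Lemma wiener_small_subtrees r a k : r \in branching T -> #|branching T| <= k.+1 ->
    (forall v, v != r -> #|subtree (parent r) v| <= a) -> 0 < a -> a.*2 <= n -> k < n ->
  wiener T <= k * cut n a + (n - k.+1) * (n - 1).
Proof.
move=> rB leB le_a a0 an kn; apply: leq_trans (wiener_le_cuts connT r cardT) _.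
set N := [set v | (v != r) && (1 < #|subtree (parent r) v|)].
have rN : r \notin N by rewrite in_set eqxx.
have cN : #|N| <= k by have := leq_trans (card_nonroot_branching rB) leB.
apply: leq_trans (cut_sum_leaves cardT rN (subxx _)) _.
have [d eq_k] : exists d, k = #|N| + d by exists (k - #|N|); rewrite subnKC.
apply: (@leq_trans (#|N| * cut n a + (n - #|N|.+1) * (n - 1))).
  rewrite leq_add2r -sum_nat_const; apply: leq_sum => v.
  by rewrite in_set => /andP[/le_a le_v _]; apply: le_cut => //; move: le_v an; clear; lia.
have le1 : n - 1 <= cut n a.
  by rewrite -[n - 1]mul1n; apply: (@le_cut n 1 a) => //; move: a0 an; clear; lia.
rewrite eq_k mulnDl -addnA leq_add2l; apply: (@leq_trans ((d + (n - (#|N| + d).+1)) * (n - 1))).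
  by rewrite leq_mul2r; apply/orP; right; clear; lia.
by rewrite mulnDl leq_add2r leq_mul2l le1 orbT.
Qed.

End TreeBounds.

(** * The upper bound *)

Lemma nth_rotC (T : Type) (x0 : T) (s : seq T) i j : i < size s -> j < size s ->
  nth x0 (rot i s) j = nth x0 (rot j s) i.
Proof.
have nth_rot a b : a < size s -> b < size s ->
    nth x0 (rot a s) b = nth x0 s (if a + b < size s then a + b else a + b - size s).
  move=> lt_a lt_b; rewrite /rot nth_cat size_drop ltn_subRL; case: ifP => ab.
    by rewrite nth_drop.
  rewrite nth_take; last by lia.
  by congr nth; lia.
by move=> lt_i lt_j; rewrite !nth_rot // addnC.
Qed.

Lemma sum_nth_rot (T : Type) (x0 : T) (s : seq T) (f : T -> nat) j :
  \sum_(i < size s) f (nth x0 (rot j s) i) = \sum_(x <- s) f x.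
Proof.
rewrite -[in LHS](size_rot j s) -(big_mkord xpredT (fun i => f (nth x0 (rot j s) i))).
rewrite -(big_nth x0 xpredT f) /rot big_cat /= addnC.
by rewrite -big_cat cat_take_drop.
Qed.

(** By [(1 + a) (1 + z) >= 1 + a + z] the loss of each rotation is at least the linear form [l]. Its
    sum over the rotations exceeds [g (2 (R + g) - 6)] by at least [g (g - 4) + R (4g - 20)], which
    is positive for [g >= 5], so some rotation is above the average. *)
Lemma long_cycle_average (g : nat) (a b y z : 'I_g -> nat) R :
    4 < g -> \sum_i a i = R -> \sum_i b i = R -> \sum_i y i = R -> \sum_i z i = R ->
  exists i, 2 * (R + g) - 5 <=
    (g - 2) * ((a i).+1 * (z i).+1) +
    (g - 4) * ((a i).+1 * (y i).+1 + (b i).+1 * (z i).+1).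
Proof.
move=> g4 sa sb sy sz; pose L i := (g - 2) * ((a i).+1 * (z i).+1) +
    (g - 4) * ((a i).+1 * (y i).+1 + (b i).+1 * (z i).+1).
pose l i := (3 * g - 10) + (2 * g - 6) * (a i + z i) + (g - 4) * (y i + b i).
have le_l i : l i <= L i.
  rewrite /l /L; have [t ->] : exists t, g = t + 5 by exists (g - 5); lia.
  have -> : 3 * (t + 5) - 10 = 3 * t + 5 by lia.
  have -> : 2 * (t + 5) - 6 = 2 * t + 4 by lia.
  have -> : t + 5 - 2 = t + 3 by lia.
  have -> : t + 5 - 4 = t + 1 by lia.
  by nia.
have : (g * (2 * (R + g) - 6)).+1 <= \sum_i l i.
  rewrite /l !big_split -!big_distrr !big_split /= sa sb sy sz sum_nat_const card_ord.
  have [t ->] : exists t, g = t + 5 by exists (g - 5); lia.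
  have -> : 3 * (t + 5) - 10 = 3 * t + 5 by lia.
  have -> : 2 * (t + 5) - 6 = 2 * t + 4 by lia.
  have -> : t + 5 - 4 = t + 1 by lia.
  have -> : 2 * (R + (t + 5)) - 6 = 2 * R + 2 * t + 4 by lia.
  by nia.
move=> lt_sum; have [i lt_i] : exists i, 2 * (R + g) - 6 < l i.
  apply/existsP; apply: contraLR lt_sum => /existsPn no; rewrite -leqNgt.
  apply: (@leq_trans (\sum_(i < g) (2 * (R + g) - 6))).
    by apply: leq_sum => i _; rewrite leqNgt no.
  by rewrite sum_nat_const card_ord.
exists i; apply: leq_trans (le_l i).
by apply: leq_trans lt_i; lia.
Qed.

(** The condition singles out the last pairs, and at least [al - a] of them, where [a] is half of
    [n - 2k - 1] rounded up. *)
Lemma saving_sum n k al : al.*2 + 2 <= n -> k.*2.+1 <= n ->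
  (al - uphalf (n - k.*2.+1)).*2 <= \sum_(j < k) (if n - j.*2.+1 <= al.*2 then 2 else 0).
Proof.
move=> le_al; elim: k => [|k IHk] le_k; first by rewrite big_ord0; lia.
rewrite big_ord_recr /=; have := IHk (ltac:(lia)).
by move: (\sum_(_ < _) _) => s; case: (leqP (n - k.*2.+1) al.*2) => ?; lia.
Qed.

(* Least possible excess of the tree bound over the Wiener index when n >= 2m + 3, with
   k = m - 1: it equals 2 (n - 2 - a) for a = uphalf (n - 2m + 1). *)
Definition deficit (n k : nat) : nat := n + k.*2 - 3 - ~~ odd n.

Lemma deficitE n k : k.*2 + 5 <= n ->
  deficit n k + (uphalf (n - k.*2.+1)).*2 = (n - 2).*2.
Proof. by rewrite /deficit; case: (boolP (odd n)) => ?; lia. Qed.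

(** Having one non-leaf vertex less replaces the last balanced pair by a single cut and a leaf. The
    [+ 1] on the right is paid by the deletion of the edge between two branches of weight one. *)
Lemma odd_bound_deficit n k : k.+1.*2 + 5 <= n ->
  \sum_(j < k) balanced_cuts n (n - j.*2.+1) + cut n (n - k.*2)./2
    + (n - k.*2.+2) * (n - 1) + deficit n k.+1 <= tree_bound n k.+1 + 1.
Proof.
move=> le_n; rewrite /tree_bound big_ord_recr /=.
set S := \sum_(_ < k) _.
suff : cut n (n - k.*2)./2 + (n - 1) + deficit n k.+1 <= balanced_cuts n (n - k.*2.+1) + 1.
  have -> : n - k.*2.+2 = (n - k.+1.*2.+1).+1 by lia.
  by rewrite mulSn; lia.
have := deficitE le_n; rewrite /balanced_cuts /cut.
have [a na] : exists a, n = a.*2 + k.*2 + 7 \/ n = a.*2 + k.*2 + 8.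
  by exists (n - k.*2 - 7)./2; lia.
case: na => eq_n.
  have -> : (n - k.*2)./2 = a + 3 by lia.
  have -> : (n - k.*2.+1)./2 = a + 3 by lia.
  have -> : uphalf (n - k.*2.+1) = a + 3 by lia.
  have -> : uphalf (n - k.+1.*2.+1) = a + 2 by lia.
  have -> : n - (a + 3) = a + k.*2 + 4 by lia.
  move=> defL; have -> : deficit n k.+1 = a.*2 + k.*2.*2 + 6 by lia.
  have -> : n - 1 = a.*2 + k.*2 + 6 by lia.
  by clear; nia.
have -> : (n - k.*2)./2 = a + 4 by lia.
have -> : (n - k.*2.+1)./2 = a + 3 by lia.
have -> : uphalf (n - k.*2.+1) = a + 4 by lia.
have -> : uphalf (n - k.+1.*2.+1) = a + 3 by lia.
have -> : n - (a + 3) = a + k.*2 + 5 by lia.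
have -> : n - (a + 4) = a + k.*2 + 4 by lia.
move=> defL; have -> : deficit n k.+1 = a.*2 + k.*2.*2 + 6 by lia.
have -> : n - 1 = a.*2 + k.*2 + 7 by lia.
by clear; nia.
Qed.

Section UpperBound.
Variables (G : sgraph) (C : {set {set G}}) (n k : nat).
Hypothesis connG : connected_graph G.
Hypothesis uniqC : forall C' : {set {set G}}, is_cycle C' -> C' = C.
Hypothesis cardG : #|G| = n.
Hypothesis matchG : matching_number G <= k.+1.
Hypothesis le_kn : k.*2.+2 <= n.
Hypothesis n_gt2 : 2 < n.
Local Notation e := (@sedge G).
Local Notation w := (weight C).

Lemma branching_opened x0 p : traces C (x0 :: p) ->
  #|branching (opened x0 p)| <= k.*2.+1.
Proof.
move=> tr; have [->|B0] := eqVneq (branching (opened x0 p)) set0; first by rewrite cards0.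
have := branching_lt_matching (connected_opened connG tr) (acyclic_opened uniqC tr) B0.
have : matching_number (opened x0 p) <= matching_number G by apply: matching_number_del.
by move: matchG; card_lia.
Qed.

Lemma wiener_opened x0 p : traces C (x0 :: p) -> wiener (opened x0 p) <= tree_bound n k.
Proof.
move=> tr; apply: wiener_tree => //; first exact: (connected_opened connG tr).
  exact: branching_opened tr.
by move: le_kn; clear; lia.
Qed.

Lemma traced_loss x0 p loss : traces C (x0 :: p) ->
    wiener G + loss <= wiener (opened x0 p) ->
  wiener G + loss <= tree_bound n k.
Proof. by move=> tr le_l; apply: leq_trans le_l (wiener_opened tr). Qed.

Lemma long_cycle_bound x0 p : traces C (x0 :: p) -> 4 < size (x0 :: p) ->
  wiener G + (2 * n - 5) <= tree_bound n k.
Proof.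
move=> tr g4; set c := x0 :: p in tr g4; set g := size c in g4.
pose f j (i : 'I_g) := (w (nth x0 (rot j c) i)).-1.
have W x : x \in c -> w x = (w x).-1.+1.
  by move=> xc; rewrite prednK // (weight_gt0 connG uniqC tr).
have sumw : \sum_(x <- c) (w x).-1 + g = n.
  rewrite -cardG -(weight_sum connG tr) -/c /g -sum1_size -big_split /=.
  by apply: eq_big_seq => x /W {2}->; rewrite addn1.
have sf j : \sum_i f j i = \sum_(x <- c) (w x).-1 by exact: sum_nth_rot.
have [i] := long_cycle_average g4 (sf 0) (sf 1) (sf (g - 2)) (sf (g - 1)).
rewrite sumw /f => le_i.
have lt_i : i < size c by exact: ltn_ord.
have tr_i : traces C (rot i c) by apply: traces_rot.
have sr : size (rot i c) = g by rewrite size_rot.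
have Wi j : j < g -> (w (nth x0 (rot j c) i)).-1.+1 = w (nth x0 (rot i c) j).
  move=> lt_j; rewrite (nth_rotC x0 lt_i lt_j) -W // -(mem_rot j) mem_nth // size_rot.
  exact: ltn_ord.
rewrite !Wi in le_i; try lia.
case def_r : (rot i c) tr_i sr le_i {Wi} => [|y q] tr_i sr le_i.
  by case: tr_i.
have := wiener_open_cycle connG uniqC tr_i; rewrite sr.
have eqn j : j < g -> nth x0 (y :: q) j = nth y (y :: q) j.
  by move=> lt_j; apply: set_nth_default; rewrite sr.
rewrite !eqn in le_i; try lia.
move=> le_o; apply: (traced_loss tr_i); apply: leq_trans le_o.
by rewrite leq_add2l.
Qed.

(** An edge outside [C] would put [z] into the branch of [x], which consists of [x] alone. *)
Lemma pendant_cycle_edge x0 p x z : traces C (x0 :: p) ->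
  x \in x0 :: p -> w x = 1 -> e x z -> [set x; z] \in C.
Proof.
move=> tr xc w1 exz; apply: contraT => xzC.
have eF : @sedge (del_edges C) x z by rewrite del_edgeE exz.
have /cards1P[y eq_y] : #|[set v | base C v == x]| == 1 by apply/eqP.
have xy : x \in [set v | base C v == x] by rewrite in_set (base_id connG uniqC tr).
have zy : z \in [set v | base C v == x].
  by rewrite in_set -(base_connect connG uniqC tr (connect1 eF)) (base_id connG uniqC tr).
have := sedge_neq exz; rewrite eq_y in xy zy.
by rewrite (set1P xy) (set1P zy) eqxx.
Qed.

Lemma uniq_traced c : traces C c -> uniq c.
Proof. by case=> _ /andP[]. Qed.

Lemma edge_off_cycle x0 p x z : traces C (x0 :: p) ->
  x \notin x0 :: p -> e x z -> @sedge (opened x0 p) x z.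
Proof. by move=> tr xc exz; apply/(sub_F_T tr)/(not_cover_edge tr). Qed.

Lemma heavy_neighbor x0 p x : traces C (x0 :: p) -> x \in x0 :: p -> 1 < w x ->
  exists2 z, @sedge (del_edges C) x z & z \notin x0 :: p.
Proof.
move=> tr xc w1; have x_in : x \in [set v | base C v == x].
  by rewrite in_set (base_id connG uniqC tr).
have /card_gt0P[z] : 0 < #|[set v | base C v == x] :\ x|.
  by move: w1; rewrite /weight (cardsD1 x) x_in.
case/setD1P=> ne_zx; rewrite in_set => /eqP bz.
have [_] := baseP connG tr z; rewrite bz connect_sedge_sym.
case/connectP=> -[|a q] /=; first by move=> _ eq_z; rewrite eq_z eqxx in ne_zx.
case/andP=> exa _ _; exists a => //; apply/negP => ac.
have := base_connect connG uniqC tr (connect1 exa).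
rewrite !(base_id connG uniqC tr) // => eq_xa.
by have := @sedge_neq (del_edges C) _ _ exa; rewrite eq_xa eqxx.
Qed.

Lemma pendant_neighbor x0 p x z : traces C (x0 :: p) ->
  x \in x0 :: p -> w x = 1 -> e x z -> z \in x0 :: p.
Proof.
by move=> tr xc w1 exz; case: (edge_in_cycle tr (pendant_cycle_edge tr xc w1 exz)).
Qed.

(* Deleting the edge opposite to the heavy vertex leaves a tree in which both light
   vertices are leaves, so that it has one branching vertex less. *)
Lemma pendant_triangle_bound y u v : traces C [:: y; u; v] -> w u = 1 -> w v = 1 ->
  0 < k -> k.*2 + 5 <= n -> wiener G + deficit n k <= tree_bound n k.
Proof.
move=> tr wu wv k0 kn; have tr' : traces C [:: v; y; u] := traces_rot 2 tr.
have loss := wiener_open_cycle connG uniqC tr'.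
rewrite /= wu wv addn0 in loss.
have /and3P[yu yv uv] : [&& y != u, y != v & u != v].
  by have := uniq_traced tr; rewrite /= !inE negb_or andbT -andbA.
set T := opened y [:: u; v]; set T' := opened v [:: y; u] in loss *.
have [yc uc vc] : [/\ y \in [:: y; u; v], u \in [:: y; u; v] & v \in [:: y; u; v]].
  by rewrite !inE !eqxx !orbT.
have wy : 1 < w y.
  have := weight_sum connG tr; rewrite !big_cons big_nil cardG wu wv; move: kn; clear; lia.
have Tyu : @sedge T y u := opened_step tr (isT : 0 < 2).
have Tuv : @sedge T u v := opened_step tr (isT : 1 < 2).
have T'E a b : @sedge T' a b -> e a b /\ [set a; b] != [set u; v].
  by rewrite openedE => /andP[].
have T'u z : @sedge T' u z -> z = y.
  move=> /T'E[euz ne_z]; have ne_uz := sedge_neq euz.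
  have := pendant_neighbor tr uc wu euz; rewrite !inE => /or3P[]/eqP eq_z //.
    by rewrite eq_z eqxx in ne_uz.
  by rewrite eq_z eqxx in ne_z.
have T'v z : @sedge T' v z -> z = y.
  move=> /T'E[evz ne_z]; have ne_vz := sedge_neq evz.
  have := pendant_neighbor tr vc wv evz; rewrite !inE => /or3P[]/eqP eq_z //.
    by rewrite eq_z setUC eqxx in ne_z.
  by rewrite eq_z eqxx in ne_vz.
have leafN x : (forall z, @sedge T' x z -> z = y) -> x \notin branching T'.
  by move=> leaf; apply/negP => /branchingP[a [b [/leaf-> /leaf->]]]; rewrite eqxx.
have uB : u \in branching T.
  by apply/branchingP; exists y, v; rewrite Tuv sedge_sym Tyu.
have sub_B : branching T' \subset branching T :\ u.
  apply/subsetP => x xB; rewrite in_setD1.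
  have -> /= : x != u by apply: contraTneq xB => ->; apply: leafN.
  have ne_xv : x != v by apply: contraTneq xB => ->; apply: leafN.
  have [->|ne_xy] := eqVneq x y.
    have [z eyz zc] := heavy_neighbor tr yc wy.
    apply/(@branchingP T); exists u, z; split=> //; first exact: sub_F_T tr _ _ eyz.
    by apply: contraNneq zc => <-.
  have ne_xu : x != u by apply: contraTneq xB => ->; apply: leafN.
  have xc : x \notin [:: y; u; v] by rewrite !inE !negb_or ne_xy ne_xu.
  have /branchingP[a [b [/T'E[exa _] /T'E[exb _] ab]]] := xB.
  by apply/(@branchingP T); exists a, b; split=> //; apply: edge_off_cycle.
have leB : #|branching T'| <= k.-1.*2.+2.
  apply: leq_trans (subset_leq_card sub_B) _.
  have := branching_opened tr; rewrite -/T (cardsD1 u) uB add1n ltnS => le_B.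
  by apply: leq_trans le_B _; move: k0; clear; lia.
have lt_kn : k.-1.*2.+1 < n by move: k0 kn; clear; lia.
have := wiener_tree_odd (connected_opened connG tr') cardG n_gt2 leB lt_kn.
(* The deletion loses [w u * w v = 1], which absorbs the [+ 1] of this inequality. *)
have := @odd_bound_deficit n k.-1; rewrite prednK // => /(_ kn).
by move: loss; rewrite -/T'; clear; lia.
Qed.

(** Opening loses 9, one less than the required 10. But with [b] as root every other subtree has at
    most 3 vertices, so the first pair has cuts 18 instead of 20, and the tree is bounded by 104
    instead of [tree_bound 9 2 = 108]. *)
Lemma balanced_triangle_bound a b d : traces C [:: a; b; d] ->
  w a = 3 -> w b = 3 -> w d = 3 -> k = 2 -> wiener G + 10 <= tree_bound n k.
Proof.
move=> tr wa wb wd eq_k.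
have eq_n : n = 9 by rewrite -cardG -(weight_sum connG tr) !big_cons big_nil wa wb wd.
have loss := wiener_open_cycle connG uniqC tr.
rewrite /= wa wd addn0 in loss; set T := opened a [:: b; d] in loss *.
have /and3P[ab ad bd] : [&& a != b, a != d & b != d].
  by have := uniq_traced tr; rewrite /= !inE negb_or andbT -andbA.
have connT : connected_graph T := connected_opened connG tr.
have Tab : @sedge T a b := opened_step tr (isT : 0 < 2).
have Tbd : @sedge T b d := opened_step tr (isT : 1 < 2).
have bB : b \in branching T.
  by apply/branchingP; exists a, d; rewrite Tbd sedge_sym Tab.
(* The two remaining cycle edges both end at [b], so a subtree that does not contain [b] stays
   within one branch. *)
have small v : v != b -> #|subtree (parent (T := T) b) v| <= 3.
  move=> ne_v; have [->|] := eqVneq 3 (w (base C v)); last first.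
    have := base_cycle connG tr v; rewrite !inE.
    by case/or3P=> /eqP->; rewrite ?wa ?wb ?wd.
  rewrite subset_leq_card //; apply/subsetP => z zv; rewrite in_set; move: zv.
  elim/(parent_ind (@parent_depth _ connT b)): z => [|z ne_z IH].
    by move=> bv; rewrite (root_in_subtree (@parent_root T b) bv) eqxx in ne_v.
  case/subtree_par=> [->//|pz]; rewrite -(eqP (IH pz)).
  have Tz := parent_edge connT ne_z; move: (Tz); rewrite openedE => /andP[ez ne_cl].
  have [zC|zC] := boolP ([set z; parent (T := T) b z] \in C); last first.
    by apply/eqP/(base_connect connG uniqC tr)/connect1; rewrite del_edgeE ez.
  have [zc pc _] := edge_in_cycle tr zC.
  have ne_p := sedge_neq ez; move: zc pc ne_cl ne_p; rewrite !inE (negbTE ne_z) /=.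
  have pb : parent (T := T) b z != b.
    apply: contraNneq ne_v => eq_p; rewrite eq_p in pz.
    by rewrite (root_in_subtree (@parent_root T b) pz).
  rewrite (negbTE pb) /= => /orP[]/eqP-> /orP[]/eqP->; rewrite ?eqxx //.
  by rewrite setUC eqxx.
have leB : #|branching T| <= 5.
  by have := branching_opened tr; rewrite eq_k.
have cT : #|T| = 9 by rewrite -eq_n -cardG.
have := wiener_small_subtrees connT cT bB leB small isT isT isT.
rewrite eq_n eq_k /tree_bound /balanced_cuts /cut !big_ord_recr big_ord0 /=.
by move: loss; clear; lia.
Qed.

(** The edge between [v] and [y] is deleted, so [v] becomes a leaf at [x]. Together with the branch
    of [x] it forms a set [B] of [w x + 1] vertices whose only gate is [x]. The loss [2 (w y)] and
    the saving at the leaf add up to the deficit. *)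
Lemma thin_square_bound y u x v : traces C [:: y; u; x; v] ->
    w u = 1 -> w v = 1 -> w x <= w y -> k.*2 + 5 <= n ->
  wiener G + deficit n k <= tree_bound n k.
Proof.
move=> tr wu wv le_xy kn; have loss := wiener_open_cycle connG uniqC tr.
rewrite /= wv addn0 muln1 in loss; set T := opened y [:: u; x; v] in loss *.
have connT : connected_graph T := connected_opened connG tr.
have eq_n : n = w y + w x + 2.
  by rewrite -cardG -(weight_sum connG tr) !big_cons big_nil wu wv; clear; lia.
have /and5P[yu yx yv ux /andP[uv xv]] :
    [&& y != u, y != x, y != v, u != x & (u != v) && (x != v)].
  by have := uniq_traced tr; rewrite /= !inE !negb_or andbT -!andbA.
have vc : v \in [:: y; u; x; v] by rewrite !inE eqxx !orbT.
have xc : x \in [:: y; u; x; v] by rewrite !inE eqxx !orbT.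
have Txv : @sedge T x v := opened_step tr (isT : 2 < 3).
have leaf_v z : @sedge T v z -> z = x.
  rewrite openedE -[closing _ _]/[set v; y] => /andP[evz ne_cl].
  have [_ + nxt] := edge_in_cycle tr (pendant_cycle_edge tr vc wv evz).
  have ne_vz := sedge_neq evz; rewrite !inE => /or4P[]/eqP eq_z //.
  - by rewrite eq_z eqxx in ne_cl.
  - move: nxt; rewrite eq_z /= ![v == _]eq_sym [u == y]eq_sym.
    rewrite (negbTE yv) (negbTE uv) (negbTE xv) (negbTE yu) !eqxx.
    by case=> eq1; [rewrite eq1 eqxx in yu | rewrite eq1 eqxx in xv].
  - by rewrite eq_z eqxx in ne_vz.
set B := v |: [set z | base C z == x].
have bx : base C x = x := base_id connG uniqC tr xc.
have bv : base C v = v := base_id connG uniqC tr vc.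
have cB : #|B| = (w x).+1 by rewrite cardsU1 in_set bv eq_sym xv.
have xB : x \in B by rewrite in_setU1 in_set bx eqxx orbT.
have exitB a z : @sedge T a z -> a \in B -> z \notin B -> a = x.
  move=> Taz; rewrite in_setU1 => /predU1P[eq_a|].
    by move: Taz; rewrite eq_a => /leaf_v->; rewrite xB.
  rewrite in_set => /eqP ba; rewrite in_setU1 negb_or in_set => /andP[_ bz].
  move: Taz; rewrite openedE => /andP[eaz _].
  have [azC|azC] := boolP ([set a; z] \in C).
    by have [ac _ _] := edge_in_cycle tr azC; rewrite -ba (base_id connG uniqC tr).
  have eF : @sedge (del_edges C) a z by rewrite del_edgeE eaz.
  by move: bz; rewrite -(base_connect connG uniqC tr (connect1 eF)) ba eqxx.
have le_x : (w x).*2 + 2 <= n by rewrite eq_n; move: le_xy; clear; lia.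
have lt_k : k.*2.+1 < n by move: kn; clear; lia.
have vB : v \in B by rewrite in_setU1 eqxx.
have Tvx : @sedge T v x by rewrite sedge_sym.
have := wiener_tree_leaf connT cardG n_gt2 Tvx leaf_v xB vB exitB cB le_x
  (branching_opened tr) lt_k.
have := saving_sum le_x (ltnW lt_k); have := deficitE kn.
move: (\sum_(j < k) _) => sv; move: loss; rewrite -/T eq_n; clear; lia.
Qed.

Lemma traced_weights x0 p : traces C (x0 :: p) -> all (fun x => 0 < w x) (x0 :: p).
Proof. by move=> tr; apply/allP => x xc; apply: weight_gt0 tr _ xc. Qed.

(** The closing edge joins the first and the last entry, so the lightest vertex goes to the middle
    to maximise the product that is lost. *)
Lemma triangle_min_middle a b d : traces C [:: a; b; d] ->
  exists a b d, [/\ traces C [:: a; b; d], w b <= w a & w b <= w d].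
Proof.
move=> tr; have tr1 : traces C [:: b; d; a] := traces_rot 1 tr.
have tr2 : traces C [:: d; a; b] := traces_rot 2 tr.
case: (leqP (w b) (w a)) => ba; case: (leqP (w b) (w d)) => bd.
- by exists a, b, d.
- by exists b, d, a; split=> //; lia.
- by exists d, a, b; split=> //; lia.
- case: (leqP (w a) (w d)) => ad; first by exists d, a, b; split=> //; lia.
  by exists b, d, a; split=> //; lia.
Qed.

(** The heavier vertex of each opposite pair becomes an end. By the last clause, if one of the two
    ends has weight one then [w f = 1], so this equation alone recognises the shape
    [(beta, 1, alpha, 1)]. *)
Lemma square_max_ends a b d f : traces C [:: a; b; d; f] ->
  exists a b d f, [/\ traces C [:: a; b; d; f], w d <= w a, w b <= w f &
                      w a < 2 -> w f < 2].
Proof.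
move=> tr.
have orient a' b' d' f' : traces C [:: a'; b'; d'; f'] -> w d' <= w a' -> w b' <= w f' ->
  exists a b d f, [/\ traces C [:: a; b; d; f], w d <= w a, w b <= w f &
                      w a < 2 -> w f < 2].
  move=> tr' da bf; case: (leqP (w f') (w a')) => fa.
    by exists a', b', d', f'; split=> //; lia.
  case: (ltnP (w a') 2) => a2; last by exists a', b', d', f'; split=> //; lia.
  have tr3 : traces C [:: f'; a'; b'; d'] := traces_rot 3 tr'.
  have /and5P[? ? ? ? _] := traced_weights tr'.
  by exists f', a', b', d'; split=> //; lia.
have tr1 : traces C [:: b; d; f; a] := traces_rot 1 tr.
have tr2 : traces C [:: d; f; a; b] := traces_rot 2 tr.
have tr3 : traces C [:: f; a; b; d] := traces_rot 3 tr.
case: (leqP (w d) (w a)) => da; case: (leqP (w b) (w f)) => bf.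
- exact: orient tr da bf.
- by apply: orient tr1 _ _; lia.
- by apply: orient tr3 _ _; lia.
- by apply: orient tr2 _ _; lia.
Qed.

Lemma wiener_upper_small c : traces C c -> wiener G + (n - 2) <= tree_bound n k.
Proof.
move=> tr; have [c3 _ _] := tr; case: c c3 tr => [|a [|b [|d [|f [|z c]]]]] // _ tr.
- have [{tr}a [{}b [{}d [tr ba bd]]]] := triangle_min_middle tr.
  apply: (traced_loss tr); apply: leq_trans (wiener_open_cycle connG uniqC tr).
  rewrite leq_add2l /= addn0.
  have /and4P[_ b0 _ _] := traced_weights tr.
  rewrite -cardG -(weight_sum connG tr) !big_cons big_nil; move: b0 ba bd => /=.
  move: (w a) (w b) (w d); clear => wa wb wd b0 ba bd.
  have [y eq_y] : exists y, wa = y + wb by exists (wa - wb); lia.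
  have [z eq_z] : exists z, wd = z + wb by exists (wd - wb); lia.
  subst wa wd; case: wb b0 {ba bd} => [|[|x]] // _; first by nia.
  have -> : y + x.+2 + (x.+2 + (z + x.+2 + 0)) - 2 = 3 * x + 4 + y + z by lia.
  by nia.
- have [{tr}a [{}b [{}d [{}f [tr da bf _]]]]] := square_max_ends tr.
  apply: (traced_loss tr); apply: leq_trans (wiener_open_cycle connG uniqC tr).
  rewrite leq_add2l /= addn0.
  have /and5P[_ b0 d0 _ _] := traced_weights tr.
  rewrite -cardG -(weight_sum connG tr) !big_cons big_nil; move: b0 d0 da bf => /=.
  move: (w a) (w b) (w d) (w f); clear => wa wb wd wf b0 d0 da bf.
  (* Since [d <= a] and [b <= f] in weights, the claim reduces to [(a - 1) (f - 1) >= 0]; the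
     substitutions expose these factors. *)
  have [y eq_y] : exists y, wa = y + 1 by exists (wa - 1); lia.
  have [z eq_z] : exists z, wf = z + 1 by exists (wf - 1); lia.
  by subst wa wf; nia.
- apply: leq_trans (long_cycle_bound tr isT); rewrite leq_add2l.
  by move: n_gt2; clear; lia.
Qed.

Lemma wiener_upper_large c : traces C c -> 0 < k -> k.*2 + 5 <= n ->
  wiener G + deficit n k <= tree_bound n k.
Proof.
move=> tr k0 kn; have [c3 _ _] := tr.
(* This is where [2k <= n - 5] enters; [2n - 8] is the loss reached by all triangles and squares
   outside the exceptional shapes. *)
have le_def : deficit n k <= 2 * n - 8 by rewrite /deficit; move: kn; clear; lia.
case: c c3 tr => [|a [|b [|d [|f [|z c]]]]] // _ tr.
- have [{tr}a [{}b [{}d [tr ba bd]]]] := triangle_min_middle tr.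
  have /and4P[a0 b0 d0 _] := traced_weights tr.
  have eq_n : n = w a + w b + w d.
    by rewrite -cardG -(weight_sum connG tr) !big_cons big_nil; clear; lia.
  have [eq_a|ne_a] := eqVneq (w a) 1.
    have tr1 : traces C [:: d; a; b] := traces_rot 2 tr.
    by apply: (pendant_triangle_bound tr1) => //; move: b0 ba; rewrite eq_a; clear; lia.
  have [eq_d|ne_d] := eqVneq (w d) 1.
    by apply: (pendant_triangle_bound tr) => //; move: b0 bd; rewrite eq_d; clear; lia.
  have [/andP[/andP[/eqP wa /eqP wb] /eqP wd]|ne3] :=
    boolP ((w a == 3) && (w b == 3) && (w d == 3)).
    have [eq_k|ne_k] := eqVneq k 2.
      apply: leq_trans (balanced_triangle_bound tr wa wb wd eq_k).
      by rewrite leq_add2l /deficit eq_n wa wb wd eq_k.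
    (* Here [n = 9] leaves only [k = 1], where the deficit is 8 and the loss of 9 suffices. *)
    apply: (traced_loss tr); apply: leq_trans (wiener_open_cycle connG uniqC tr).
    rewrite leq_add2l /= wa wd /deficit; move: kn; rewrite eq_n wa wb wd.
    by move: ne_k; clear; lia.
  apply: (traced_loss tr); apply: leq_trans (wiener_open_cycle connG uniqC tr).
  rewrite leq_add2l /= addn0 mul1n; apply: leq_trans le_def _.
  rewrite eq_n; move: a0 b0 d0 ba bd ne_a ne_d ne3.
  move: (w a) (w b) (w d); clear => wa wb wd a0 b0 d0 ba bd ne_a ne_d ne3.
  have [eq_b|[eq_b|[x eq_b]]] : wb = 1 \/ wb = 2 \/ exists x, wb = x + 3.
  + by case: wb b0 {ba bd ne3} => [|[|[|x]]] //; auto; right; right; exists x; lia.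
  + have [y eq_y] : exists y, wa = y + 2 by exists (wa - 2); lia.
    have [z eq_z] : exists z, wd = z + 2 by exists (wd - 2); lia.
    by subst wa wd wb; nia.
  + have [y eq_y] : exists y, wa = y + 2 by exists (wa - 2); lia.
    have [z eq_z] : exists z, wd = z + 2 by exists (wd - 2); lia.
    by subst wa wd wb; nia.
  (* The product of the end weights is compared with [2n - 8]. At [(3, 3, 3)] it is 9 against 10;
     any excess over these weights closes the gap. *)
  + have [y eq_y] : exists y, wa = y + (x + 3) by exists (wa - (x + 3)); lia.
    have [z eq_z] : exists z, wd = z + (x + 3) by exists (wd - (x + 3)); lia.
    subst wa wd wb; have : 0 < x + y + z by lia.
    by clear; nia.
- have [{tr}a [{}b [{}d [{}f [tr da bf a2]]]]] := square_max_ends tr.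
  have /and5P[_ b0 d0 _ _] := traced_weights tr.
  have [f1|f2] := leqP (w f) 1.
    by apply: (thin_square_bound tr) => //; move: f1 b0 bf; clear; lia.
  apply: (traced_loss tr); apply: leq_trans (wiener_open_cycle connG uniqC tr).
  rewrite leq_add2l /= addn0; apply: leq_trans le_def _.
  rewrite -cardG -(weight_sum connG tr) !big_cons big_nil; move: b0 d0 da bf a2 f2 => /=.
  move: (w a) (w b) (w d) (w f); clear => wa wb wd wf b0 d0 da bf a2 f2.
  have [y eq_y] : exists y, wa = y + 2 by exists (wa - 2); lia.
  have [z eq_z] : exists z, wf = z + 2 by exists (wf - 2); lia.
  by subst wa wf; nia.
- apply: leq_trans (long_cycle_bound tr isT); rewrite leq_add2l.
  by apply: leq_trans le_def _; clear; lia.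
Qed.

End UpperBound.

(** * Extremal graphs *)

Lemma next_neq_prev (T : eqType) (c : seq T) x : uniq c -> 2 < size c -> x \in c ->
  next c x != prev c x.
Proof.
move=> uc c3 xc; have [i s def_s] := rot_to xc.
rewrite -(next_rot i uc) -(prev_rot i uc) def_s.
have : uniq (x :: s) by rewrite -def_s rot_uniq.
have : 2 < size (x :: s) by rewrite -def_s size_rot.
have prev_last z t u : x \notin rcons t z -> prev_at x x u (rcons t z) = z.
  elim: t u => [|v t IHt] u /=; rewrite !inE; first by move/negbTE->; rewrite eqxx.
  by rewrite negb_or => /andP[/negbTE-> /IHt].
case/lastP: s {def_s} => // s z; rewrite cons_uniq [size _]/= size_rcons => s2 /andP[xs us].
rewrite [prev _ _]/= prev_last //; case: s s2 us {xs} => // y s _ /=; rewrite eqxx.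
by case/andP=> ys _; apply: contraNneq ys => ->; rewrite mem_rcons inE eqxx.
Qed.

Lemma card_ord_interval n x y : x <= y -> y <= n -> #|[set u : 'I_n | x <= u < y]| = y - x.
Proof.
move=> xy yn; rewrite -sum1dep_card -(big_mkord (fun u => x <= u < y) (fun=> 1)).
rewrite -[RHS]muln1 -[RHS]sum_nat_const_nat (big_nat_widen x y n) //.
by rewrite (big_nat_widenl x 0) //; apply: eq_bigl => i; rewrite andbC.
Qed.

Section Extremal.
Variables n m b g : nat.
Hypothesis hm : 2 <= m.
Hypothesis hb : m.*2 + b <= n.
Hypothesis hg : (g == 3) && (m.*2 + b == n) || (g == 4).

(* The path 0, 1, ..., 2m - 1, closed into a cycle by the edge {0, g - 1}, with [b] leaves
   attached to its end 2m - 1 and the remaining n - 2m - b leaves attached to 1. *)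
Definition tree_parent (v : nat) : nat :=
  if v < m.*2 then v.-1 else if v < m.*2 + b then m.*2.-1 else 1.

Definition lower_adj (u v : nat) : bool :=
  (0 < v) && (u == tree_parent v) || (u == 0) && (v == g.-1).

Lemma lower_adjP u v : v < n -> lower_adj u v ->
  (v < m.*2 /\ v = u.+1) \/ (m.*2 <= v /\ v < m.*2 + b /\ u = m.*2.-1) \/
  (m.*2 + b <= v /\ g = 4 /\ u = 1) \/ (u = 0 /\ v = g.-1).
Proof.
move=> lt_v; rewrite /lower_adj /tree_parent.
by case: (ltnP v m.*2) => ?; [|case: (ltnP v (m.*2 + b)) => ?]; move: hg; lia.
Qed.

Lemma lower_adj_lt u v : v < n -> lower_adj u v -> u < v.
Proof. by move=> lt_v /(lower_adjP lt_v); move: hm hg; lia. Qed.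

Definition ext_adj (u v : 'I_n) : bool := lower_adj u v || lower_adj v u.

Lemma ext_adj_sym : symmetric ext_adj.
Proof. by move=> u v; rewrite /ext_adj orbC. Qed.

Lemma ext_adj_irrefl : irreflexive ext_adj.
Proof.
by move=> u; rewrite /ext_adj orbb; apply/negP => /(lower_adj_lt (ltn_ord u)); rewrite ltnn.
Qed.

Definition ext_graph : sgraph := SGraph ext_adj_sym ext_adj_irrefl.
Local Notation H := ext_graph.

Lemma ext_edge_lt (u v : H) : sedge u v -> u < v -> lower_adj u v.
Proof.
by case/orP=> // /(lower_adj_lt (ltn_ord u)) lt_vu /(ltn_trans lt_vu); rewrite ltnn.
Qed.

Lemma n_gt3 : 3 < n. Proof. by move: hm hb; lia. Qed.

Definition vtx (i : nat) : H := insubd (Ordinal (ltn_trans (isT : 0 < 3) n_gt3)) i.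

Lemma vtxE i : i < n -> vtx i = i :> nat.
Proof. by move=> lt_i; rewrite val_insubd lt_i. Qed.

Lemma path_edge i : i.+1 < m.*2 -> sedge (vtx i) (vtx i.+1).
Proof.
move=> lt_i; have lt_n : i.+1 < n by move: hb; lia.
by rewrite /= /ext_adj !vtxE ?(ltnW lt_n) // /lower_adj /tree_parent lt_i eqxx.
Qed.

Lemma closing_edge_ext : sedge (vtx 0) (vtx g.-1).
Proof.
have lt_g : g.-1 < n by move: hg n_gt3; lia.
by rewrite /= /ext_adj !vtxE // /lower_adj ?eqxx ?orbT //; move: n_gt3; lia.
Qed.

Lemma ext_connected : connected_graph H.
Proof.
have to0 (v : H) : connect (@sedge H) v (vtx 0).
  have [k le_k] := ubnP (v : nat); elim: k v le_k => // k IHk v le_k.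
  have [v0|v0] := posnP (v : nat).
    rewrite (_ : v = vtx 0) ?connect0 //; apply: val_inj.
    by rewrite /= vtxE //; move: n_gt3; lia.
  have lt_p : tree_parent v < v by rewrite /tree_parent; case: (ltnP v m.*2) => ?;
    [|case: (ltnP v (m.*2 + b)) => ?]; move: hm v0; lia.
  have lt_pn : tree_parent v < n by apply: ltn_trans lt_p _.
  apply: (connect_trans (y := vtx (tree_parent v))); last first.
    by apply: IHk; rewrite vtxE //; apply: leq_trans lt_p _.
  apply: connect1; rewrite sedge_sym /= /ext_adj vtxE //.
  by rewrite /lower_adj v0 eqxx.
by move=> u v; apply: connect_trans (to0 u) _; rewrite connect_sedge_sym.
Qed.

Definition ext_cycle : {set {set H}} :=
  [set [set p.1; p.2] | p : H * H & [&& p.1 < g, p.2 < g & sedge p.1 p.2]].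

Lemma ext_small_edge (u v : H) : u < v -> v < g -> sedge u v ->
  v = u.+1 :> nat \/ (u = 0 :> nat /\ v = g.-1 :> nat).
Proof.
move=> lt_uv lt_v euv; have := lower_adjP (ltn_ord v) (ext_edge_lt euv lt_uv).
by move: hm hg; lia.
Qed.

(** The largest vertex of a cycle has two distinct lower neighbours, and only [g - 1] has two. So
    the cycle stays below [g], where each of its vertices has no neighbours but its two cycle
    neighbours; this makes it closed under adjacency below [g]. *)
Lemma ext_cycle_uniq (C : {set {set H}}) : is_cycle C -> C = ext_cycle.
Proof.
case=> c [c3 /andP[cyc uc] ->].
have [x0 x0c] : exists x, x \in c.
  by case: c c3 {cyc uc} => // x c _; exists x; rewrite mem_head.
case: (@arg_maxnP H x0 (fun x => x \in c) (fun x => x : nat) x0c) => v vc max_v {x0 x0c}.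
have {}max_v x : x \in c -> x <= v := max_v x.
have nbr x : x \in c -> [/\ sedge x (next c x), sedge x (prev c x), next c x != prev c x,
    next c x \in c & prev c x \in c].
  move=> xc; rewrite next_neq_prev // mem_next mem_prev xc next_cycle //.
  by rewrite sedge_sym prev_cycle.
have lower x : x \in c -> sedge v x -> lower_adj x v.
  move=> xc evx; have := max_v x xc; rewrite leq_eqVlt => /orP[/eqP/val_inj eq_x|].
    by rewrite eq_x sedge_irrefl in evx.
  by apply: ext_edge_lt; rewrite sedge_sym.
have [en ep ne_np nc pc] := nbr v vc.
have eq_v : v = g.-1 :> nat.
  have := lower_adjP (ltn_ord v) (lower _ nc en).
  have := lower_adjP (ltn_ord v) (lower _ pc ep).
  have : (next c v : nat) <> prev c v by move/val_inj/eqP; rewrite (negbTE ne_np).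
  by move: hm hg; lia.
have lt_g (x : H) : x \in c -> x < g by move/max_v; rewrite eq_v; move: hg; lia.
have cl (x y : H) : x \in c -> y < g -> sedge x y -> y = next c x \/ y = prev c x.
  move=> xc lt_y exy; have [exn exp ne nxc pxc] := nbr x xc.
  have small (z : H) : sedge x z -> z < g -> z = x.+1 :> nat \/ x = z.+1 :> nat \/
      (x = 0 :> nat /\ z = g.-1 :> nat) \/ (z = 0 :> nat /\ x = g.-1 :> nat).
    move=> exz lt_z; case: (ltngtP x z) => xz.
    - by case: (ext_small_edge xz lt_z exz); tauto.
    - rewrite sedge_sym in exz.
      by case: (ext_small_edge xz (lt_g _ xc) exz); tauto.
    - by move: exz; rewrite (val_inj xz) sedge_irrefl.
  have := small _ exy lt_y; have := small _ exn (lt_g _ nxc); have := small _ exp (lt_g _ pxc).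
  have ne' : (next c x : nat) <> prev c x by move/val_inj/eqP; rewrite (negbTE ne).
  have lt_x := lt_g _ xc => s1 s2 s3.
  have : (y : nat) = next c x \/ (y : nat) = prev c x.
    by move: hg lt_x lt_y (lt_g _ nxc) (lt_g _ pxc); clear -s1 s2 s3 ne'; lia.
  by case=> /val_inj ->; [left|right].
have closed (x y : H) : x \in c -> y < g -> sedge x y -> y \in c.
  by move=> xc lt_y exy; have [_ _ _ ? ?] := nbr x xc; case: (cl x y xc lt_y exy) => ->.
have allc i : i < g -> vtx i \in c.
  have g4 : 2 < g <= 4 by move: hg; lia.
  have gm : g <= m.*2 by move: hg hm; lia.
  elim: i => [|i IHi] lt_i.
    have v_g : v = vtx g.-1 by apply: val_inj; rewrite /= vtxE //; move: n_gt3; lia.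
    apply: (closed v) => //; first by rewrite vtxE; move: n_gt3; lia.
    by rewrite v_g sedge_sym closing_edge_ext.
  apply: (closed (vtx i)); first by apply: IHi; lia.
    by rewrite vtxE //; move: n_gt3; lia.
  by apply: path_edge; lia.
apply/setP => E; apply/imsetP/imsetP => [[x xc ->]|[[x y] /=]].
  have [exn _ _ nxc _] := nbr x xc; exists (x, next c x) => //.
  by rewrite inE /= !lt_g.
rewrite inE => /and3P[/= lt_x lt_y exy] ->.
have inc (z : H) : z < g -> z \in c.
  by move=> lt_z; have := allc z lt_z; congr (_ \in c); apply: val_inj; rewrite /= vtxE.
have [xc yc] := (inc x lt_x, inc y lt_y).
case: (cl x y xc lt_y exy) => eq_y; first by exists x; rewrite // eq_y.
by exists y; rewrite // eq_y next_prev // setUC.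
Qed.

Lemma ext_unicyclic : unicyclic H.
Proof.
split; first exact: ext_connected.
suff [C cC] : exists C : {set {set H}}, is_cycle C.
  by exists C; split=> // C' /ext_cycle_uniq ->; apply: ext_cycle_uniq.
have n4 := n_gt3; have m4 : 3 < m.*2 by move: hm; lia.
have e01 := @path_edge 0 (ltnW (ltnW m4)); have e12 := @path_edge 1 (ltnW m4).
have e23 := @path_edge 2 m4.
have e0g := closing_edge_ext; rewrite sedge_sym in e0g.
have ne i j : i < n -> j < n -> i != j -> vtx i != vtx j.
  by move=> li lj; apply: contra => /eqP/(congr1 val); rewrite /= !vtxE // => ->.
case/orP: hg => [/andP[/eqP g3 _]|/eqP g4].
  exists [set [set x; next [:: vtx 0; vtx 1; vtx 2] x] | x in [:: vtx 0; vtx 1; vtx 2]].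
  exists [:: vtx 0; vtx 1; vtx 2]; split=> //; apply/andP; split.
    by rewrite g3 in e0g; apply/and4P; split.
  by rewrite /= !inE !negb_or !ne //; lia.
pose c := [:: vtx 0; vtx 1; vtx 2; vtx 3].
exists [set [set x; next c x] | x in c]; exists c; split=> //; apply/andP; split.
  by rewrite g4 in e0g; apply/and5P; split.
by rewrite /= !inE !negb_or !ne //; lia.
Qed.

(** The edges that miss the odd vertices 3, 5, ..., [2m - 1] form a triangle for [g = 3] and a star
    at 1 for [g = 4], so a matching contains at most one of them. *)
Lemma low_edge (u v : H) : u < v -> sedge u v ->
    (forall i, 0 < i < m -> u <> i.*2.+1 :> nat /\ v <> i.*2.+1 :> nat) ->
  (u = 0 :> nat /\ v = 1 :> nat) \/ (u = 1 :> nat /\ v = 2 :> nat) \/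
  (u = 0 :> nat /\ v = 2 :> nat /\ g = 3) \/ (u = 1 :> nat /\ g = 4).
Proof.
move=> lt_uv euv low; have := lower_adjP (ltn_ord v) (ext_edge_lt euv lt_uv).
have := low (u : nat)./2; have := low (v : nat)./2; have := low m.-1; have := low 1.
move: (u : nat) (v : nat) hm hg lt_uv => {low euv} {}u {}v m2 g34 lt_uv l1 lm lv lu.
case=> [[lt_v eq_v]|[[v1 [v2 eq_u]]|[[v1 [g4 eq_u]]|[eq_u eq_v]]]]; last first.
- case/orP: g34 => [/andP[/eqP g3 _]|/eqP g4].
    by right; right; left; rewrite eq_u eq_v g3.
  by have [_ []] := l1 m2; rewrite eq_v g4.
- by right; right; right.
- have [|[]] := lm; first by clear -m2; lia.
  by rewrite eq_u; clear -m2; lia.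
- have [odd_u|even_u] := boolP (odd u).
    have [u0|u0] := posnP u./2; first by right; left; clear -odd_u u0 eq_v; lia.
    have [|[]] := lu; first by clear -u0 lt_v eq_v; lia.
    by clear -odd_u; lia.
  have [v0|v0] := posnP v./2; first by left; clear -even_u v0 eq_v; lia.
  have [|_ []] := lv; first by clear -v0 lt_v; lia.
  by clear -even_u eq_v; lia.
Qed.

(** Each edge of the matching is labelled by some [i > 0] with [2i + 1] among its ends, or by 0 if
    there is none. Equal positive labels mean a shared vertex, and two edges labelled 0 always
    meet. *)
Lemma ext_matching_le : matching_number H <= m.
Proof.
apply/bigmax_leqP => M /andP[sM tM].
have m0 : 0 < m by move: hm; lia.
pose token (E : {set H}) : 'I_m :=
  odflt (Ordinal m0) [pick i : 'I_m | (0 < i) && (vtx i.*2.+1 \in E)].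
suff inj_t : {in M &, injective token}.
  by rewrite -(card_in_imset inj_t) -[leqRHS]card_ord max_card.
have tokenP E : (0 < token E /\ vtx (token E).*2.+1 \in E) \/
    (forall i, 0 < i < m -> vtx i.*2.+1 \notin E) /\ token E = 0 :> nat.
  rewrite /token; case: pickP => [i /andP[i0 iE]|none] /=; first by left.
  right; split=> // i /andP[i0 lt_i]; have := none (Ordinal lt_i).
  by rewrite /= i0 /= => ->.
have tokenP' E : 0 < token E -> vtx (token E).*2.+1 \in E.
  by case: (tokenP E) => -[] // _ ->.
have edgeP E : E \in M -> exists u v : H, [/\ u < v, sedge u v & E = [set u; v]].
  move=> /(subsetP sM)/imsetP[[u v]]; rewrite inE /= => euv ->.
  case: (ltngtP u v) => uv; first by exists u, v.
    by exists v, u; rewrite setUC; split=> //; move: euv; rewrite /ext_adj orbC.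
  by move: euv; rewrite (val_inj uv) ext_adj_irrefl.
move=> E1 E2 M1 M2 eq_t; apply/eqP; apply: contraT => neE.
have /pred0P dis := (trivIsetP tM) E1 E2 M1 M2 neE.
have [t0|t0] := posnP (token E1); last first.
  have /= := dis (vtx (token E1).*2.+1).
  by have := tokenP' E2; rewrite -eq_t tokenP' // => ->.
have [u1 [v1 [lt1 e1 eqE1]]] := edgeP E1 M1; have [u2 [v2 [lt2 e2 eqE2]]] := edgeP E2 M2.
have lowP E (u v : H) : E = [set u; v] -> token E = 0 :> nat -> E \in M ->
    forall i, 0 < i < m -> u <> i.*2.+1 :> nat /\ v <> i.*2.+1 :> nat.
  move=> eqE tE ME i lt_i; have lt_n : i.*2.+1 < n by move: hb lt_i; lia.
  have odd_notin : vtx i.*2.+1 \notin E.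
    by case: (tokenP E) => -[]; [rewrite tE | move/(_ i lt_i)].
  rewrite eqE !inE negb_or in odd_notin; case/andP: odd_notin => nu nv.
  split=> eq_i; [case/negP: nu|case/negP: nv]; by apply/eqP/val_inj; rewrite /= vtxE.
have t0' : token E2 = 0 :> nat by rewrite -eq_t.
have low1 := low_edge lt1 e1 (lowP _ _ _ eqE1 t0 M1).
have low2 := low_edge lt2 e2 (lowP _ _ _ eqE2 t0' M2).
have : u1 = u2 :> nat \/ u1 = v2 :> nat \/ v1 = u2 :> nat \/ v1 = v2 :> nat.
  by clear -low1 low2; lia.
move=> share; exfalso.
have common (x : H) : x \in E1 -> x \in E2 -> False.
  by move=> x1 x2; have := dis x; rewrite /= x1 x2.
by case: share => [|[|[]]] /val_inj eq_x; [apply: (common u1)|apply: (common u1)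
  |apply: (common v1)|apply: (common v1)]; rewrite ?eqE1 ?eqE2 !inE ?eq_x eqxx ?orbT.
Qed.

Lemma ext_matching_ge : m <= matching_number H.
Proof.
pose S := [set v : H | (v < m.*2) && ~~ odd v].
have -> : m = #|S|.
  have inj_d : injective (fun i : 'I_m => vtx i.*2).
    move=> i j /(congr1 val); rewrite /= !vtxE; try by move: hb (ltn_ord i) (ltn_ord j); lia.
    by move=> eq_ij; apply: val_inj => /=; lia.
  rewrite -[LHS]card_ord -(card_imset _ inj_d); apply: eq_card => v; rewrite inE.
  apply/imsetP/idP => [[i _ ->]|/andP[lt_v even_v]].
    by rewrite vtxE ?odd_double ?ltn_double ?ltn_ord //; move: hb (ltn_ord i); lia.
  have lt_h : v./2 < m by lia.
  by exists (Ordinal lt_h) => //; apply: val_inj; rewrite /= vtxE; move: (ltn_ord v) even_v; lia.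
apply: (@matching_of_fun H S (fun v => vtx v.+1)) => [v|v|u v].
- rewrite inE => /andP[lt_v even_v]; have -> : v = vtx v by apply: val_inj; rewrite /= vtxE.
  by rewrite vtxE //; apply: path_edge; move: even_v lt_v; lia.
- rewrite inE => /andP[lt_v even_v]; rewrite inE vtxE /= ?even_v ?andbF //.
  by move: hb lt_v even_v; lia.
- rewrite !inE => /andP[lt_u even_u] /andP[lt_v even_v] /(congr1 val) /=; rewrite !vtxE.
  + by move=> [/val_inj].
  + by move: hb lt_v even_v; lia.
  + by move: hb lt_u even_u; lia.
Qed.

End Extremal.

(** * Wiener index of the extremal graphs *)

Lemma dist_ge2 (G : sgraph) (u v : G) : connected_graph G -> u != v -> ~~ sedge u v ->
  1 < dist u v.
Proof.
move=> connG ne_uv; apply: contraNT; rewrite -leqNgt => le1.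
have [p [ep lp sp]] := dist_walk (connG u v); rewrite -sp in le1.
case: p ep lp le1 {sp} => [|x [|y p]] //= => [_ eq_uv|]; first by rewrite eq_uv eqxx in ne_uv.
by rewrite andbT => exy <-.
Qed.

(** Writes a gap as the number of separating thresholds. Summed over pairs, this becomes a sum of
    cuts of level sets, as for subtrees. *)
Lemma gap_levels N i j : i <= N -> j <= N ->
  \sum_(t < N) ((i <= t) != (j <= t) : nat) = gap i j.
Proof.
move=> iN jN.
have -> : gap i j = gap (minn i N) (minn j N) by rewrite (minn_idPl iN) (minn_idPl jN).
elim: {iN jN}N => [|N IHN]; first by rewrite big_ord0 !minn0.
rewrite big_ord_recr /= IHN /gap /minn.
by case: (leqP i N); case: (leqP j N) => /= *; do ?case: ltnP => *; lia.
Qed.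

Section ExtremalWiener.
Variables n m b g : nat.
Hypothesis hm : 2 <= m.
Hypothesis hb : m.*2 + b <= n.
Hypothesis hg : (g == 3) && (m.*2 + b == n) || (g == 4).
Local Notation H := (ext_graph hm hb hg).
Let connH : connected_graph H := @ext_connected n m b g hm hb hg.

(** Projection to the path of positions 0 to [2m]: the leaves at 1 go to position 0 and those at
    [2m - 1] to position [2m]. Vertex 0 shares its position with vertex [g - 2], which is its twin
    on the cycle. *)
Definition coord (v : nat) : nat :=
  if v == 0 then g - 2 else if v < m.*2 then v else if v < m.*2 + b then m.*2 else 0.

Lemma coord_lower_adj u v : v < n -> lower_adj m b g u v ->
  coord v <= coord u + 1 /\ coord u <= coord v + 1.
Proof.
move=> lt_v /(lower_adjP hm hb hg lt_v) adj; rewrite /coord; move: hm hg adj; clear.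
case: (u =P 0) => ?; case: (v =P 0) => ?;
case: (ltnP u m.*2) => ?; case: (ltnP v m.*2) => ?;
case: (ltnP u (m.*2 + b)) => ?; case: (ltnP v (m.*2 + b)) => ?; lia.
Qed.

Lemma coord_le v : coord v <= m.*2.
Proof.
rewrite /coord; case: eqP => _; first by move: hm hg; clear; lia.
by do 2!case: ltnP => //; lia.
Qed.

Lemma gap_coord_le (u v : H) : gap (coord u) (coord v) <= dist u v.
Proof.
have lip (x y : H) : sedge x y -> coord y <= coord x + 1.
  by case/orP=> /coord_lower_adj => /(_ (ltn_ord _))[].
have := dist_lipschitz lip (connH u v); have := dist_lipschitz lip (connH v u).
by rewrite (dist_sym (connH v u)) /gap; lia.
Qed.

Local Notation L v := ((m.*2 <= v) && (v < m.*2 + b)).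
Local Notation R v := (m.*2 + b <= v).

Lemma not_adj_leaves (u v : H) : m.*2 <= u -> m.*2 <= v -> ~~ sedge u v.
Proof.
have low (x y : H) : m.*2 <= x -> ~~ lower_adj m b g x y.
  move=> le_x; apply/negP => /(lower_adjP hm hb hg (ltn_ord y)).
  by move: le_x hm; clear; lia.
by move=> le_u le_v; rewrite negb_or !low.
Qed.

(** The gap of coordinates is corrected where different vertices share a position: two leaves at the
    same end have distance at least 2, and the twins 0 and [g - 2] have distance at least 1 in the
    triangle and 2 in the 4-cycle. The last term compensates for the diagonal. *)
Lemma dist_ext_ge (u v : H) :
  gap (coord u) (coord v) + 2 * (L u * L v) + 2 * (R u * R v) +
  (g - 2) * (((u : nat) == 0) * ((v : nat) == g - 2) + ((u : nat) == g - 2) * ((v : nat) == 0))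
    <= dist u v + 2 * ((u == v) * (L u + R u)).
Proof.
have g3 : 0 < g - 2 by move: hg; clear; lia.
have [->|ne_uv] := eqVneq u v.
  rewrite dist0 /gap subnn !add0n mul1n.
  have -> : ((v : nat) == 0) * ((v : nat) == g - 2) = 0.
    by case: eqP => // ->; case: eqP g3 => // <-.
  have -> : ((v : nat) == g - 2) * ((v : nat) == 0) = 0.
    by rewrite mulnC; case: eqP => // ->; case: eqP g3 => // <-.
  rewrite muln0 addn0 mulnDr.
  by case: (m.*2 <= v); case: (v < m.*2 + b); case: (m.*2 + b <= v).
rewrite mul0n muln0 addn0; have le_gap := gap_coord_le u v.
have d1 : 0 < dist u v.
  by rewrite lt0n; apply: contraNneq ne_uv => /(dist_eq0 (connH u v)) ->.
have [/andP[u1 v1]|] := boolP ((m.*2 <= u) && (m.*2 <= v)).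
  have d2 := dist_ge2 connH ne_uv (not_adj_leaves u1 v1).
  have u0 : ((u : nat) == 0) = false by apply/eqP => e0; move: u1 hm; rewrite e0; clear; lia.
  have v0 : ((v : nat) == 0) = false by apply/eqP => e0; move: v1 hm; rewrite e0; clear; lia.
  rewrite u0 v0 muln0 mul0n muln0 addn0; move: le_gap; rewrite /coord u0 v0 u1 v1 /=.
  rewrite !(ltnNge _ m.*2) u1 v1 /= !(ltnNge _ (m.*2 + b)).
  by case: (m.*2 + b <= u); case: (m.*2 + b <= v); rewrite /gap ?subnn /=; move: d2; clear; lia.
rewrite negb_and => low; have -> : L u * L v = 0.
  by case/orP: low => /negbTE ->; rewrite ?muln0.
have -> : R u * R v = 0.
  have lowR w : ~~ (m.*2 <= w) -> R w = false by move=> ?; apply/negbTE; move: hb; lia.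
  by case/orP: low => /lowR ->; rewrite ?muln0.
rewrite !muln0 !addn0.
have [pair|] := boolP (((u : nat) == 0) && ((v : nat) == g - 2) ||
                       ((u : nat) == g - 2) && ((v : nat) == 0)); last first.
  rewrite negb_or !negb_and => /andP[p1 p2].
  have -> : ((u : nat) == 0) * ((v : nat) == g - 2) = 0.
    by case/orP: p1 => /negbTE->; rewrite ?muln0.
  have -> : ((u : nat) == g - 2) * ((v : nat) == 0) = 0.
    by case/orP: p2 => /negbTE->; rewrite ?muln0.
  by rewrite muln0 addn0.
have -> : gap (coord u) (coord v) = 0.
  have c2 : coord (g - 2) = g - 2.
    rewrite /coord; case: eqP => // _; case: ltnP => // le2.
    by move: le2 hm hg; clear; lia.
  have c0 : coord 0 = g - 2 by rewrite /coord eqxx.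
  by case/orP: pair => /andP[/eqP-> /eqP->]; rewrite c0 c2 /gap subnn.
have -> : ((u : nat) == 0) * ((v : nat) == g - 2) + ((u : nat) == g - 2) * ((v : nat) == 0) = 1.
  have z2 : (g - 2 == 0) = false by case: (g - 2) g3.
  by case/orP: pair => /andP[/eqP-> /eqP->]; rewrite !eqxx z2 ?muln0.
rewrite add0n muln1; case/orP: (hg) => [/andP[/eqP eq3 _]|/eqP g4].
  by have -> : g - 2 = 1 by move: eq3; clear; lia.
have d2 : 1 < dist u v.
  apply: dist_ge2 => //.
  have low02 (x y : H) :
      ((x : nat) == 0) && ((y : nat) == g - 2) || ((x : nat) == g - 2) && ((y : nat) == 0) ->
      ~~ lower_adj m b g x y.
    move=> pxy; apply/negP => /(lower_adjP hm hb hg (ltn_ord y)).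
    by move: pxy hm g4; clear; lia.
  rewrite negb_or !low02 //.
  by rewrite orbC andbC [X in _ || X]andbC.
by have -> : g - 2 = 2 by move: g4; clear; lia.
Qed.

Lemma card_ext_interval x y : x <= y -> y <= n -> #|[set u : H | x <= u < y]| = y - x.
Proof. exact: card_ord_interval. Qed.

Local Notation r := (n - (m.*2 + b)).

Lemma card_coord_le t : 1 < t -> t < m.*2 -> #|[set u : H | coord u <= t]| = r + t.+1.
Proof.
move=> t1 t2; have -> : [set u : H | coord u <= t] =
    [set u : H | 0 <= u < t.+1] :|: [set u : H | m.*2 + b <= u < n].
  apply/setP => u; rewrite !inE ltn_ord andbT /coord ltnS /=.
  case: eqP => [->|_]; first by move: hg t1; clear; lia.
  case: ltnP => u1; first by rewrite [m.*2 + b <= u]leqNgt ltn_addr // orbF.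
  have -> : (u <= t) = false by move: t2 u1; clear; lia.
  by case: ltnP => //= _; rewrite leqNgt t2.
rewrite card_disjointU; last first.
  rewrite -setI_eq0; apply/eqP/setP => u; rewrite !inE ltn_ord andbT /=.
  by apply/negbTE; move: t2; clear; lia.
rewrite !card_ext_interval ?subn0 ?leq0n // 1?addnC //.
by move: t2 hb; clear; lia.
Qed.

Lemma card_coord0 : #|[set u : H | coord u <= 0]| = r.
Proof.
have -> : [set u : H | coord u <= 0] = [set u : H | m.*2 + b <= u < n].
  apply/setP => u; rewrite !inE ltn_ord andbT /coord.
  case: eqP => [->|]; first by move: hg hm; clear; lia.
  by case: ltnP => u1; [|case: ltnP => u2]; move: u1 hm; clear; lia.
by rewrite card_ext_interval.
Qed.

(** Position 1 holds vertex 1 and, in the triangle only, also its twin 0. *)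
Lemma card_coord1 : #|[set u : H | coord u <= 1]| = r + (5 - g).
Proof.
have -> : [set u : H | coord u <= 1] =
    [set u : H | g - 3 <= u < 2] :|: [set u : H | m.*2 + b <= u < n].
  apply/setP => u; rewrite !inE ltn_ord andbT /coord.
  case: eqP => [->|]; first by move: hg hm; clear; lia.
  by case: ltnP => u1; [|case: ltnP => u2]; move: u1 hm hg; clear; lia.
rewrite card_disjointU; last first.
  rewrite -setI_eq0; apply/eqP/setP => u; rewrite !inE ltn_ord andbT /=.
  by apply/negbTE; move: hm; clear; lia.
rewrite !card_ext_interval //; by move: hm hg hb; clear; lia.
Qed.

Lemma sum_gap_coord : \sum_(u : H) \sum_(v : H) gap (coord u) (coord v) =
  (cut n r + cut n (r + (5 - g)) + \sum_(2 <= t < m.*2) cut n (r + t.+1)).*2.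
Proof.
have cH : #|H| = n by rewrite card_ord.
have -> : \sum_(u : H) \sum_(v : H) gap (coord u) (coord v) =
    \sum_(t < m.*2) (cut n #|[set u : H | coord u <= t]|).*2.
  under eq_bigr => u _ do under eq_bigr => v _ do
    rewrite -(gap_levels (coord_le u) (coord_le v)).
  under eq_bigr => u _ do rewrite exchange_big.
  rewrite exchange_big; apply: eq_bigr => t _; rewrite -(sum_separated _ cH).
  by apply: eq_bigr => u _; apply: eq_bigr => v _; rewrite !inE.
rewrite -(big_mkord xpredT (fun t => (cut n #|[set u : H | coord u <= t]|).*2)).
rewrite big_ltn; last by move: hm; clear; lia.
rewrite big_ltn; last by move: hm; clear; lia.
rewrite card_coord0 card_coord1 !doubleD addnA; congr (_ + _).
rewrite -[RHS]mul2n big_distrr; apply: eq_big_nat => t /andP[t1 t2].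
by rewrite card_coord_le // -mul2n.
Qed.

(** The terms [b] and [r] on the right remove the diagonal from the squares: each group of leaves
    contributes its [b (b - 1)] or [r (r - 1)] beyond the cuts. *)
Lemma wiener_ext_ge :
  cut n r + cut n (r + (5 - g)) + \sum_(2 <= t < m.*2) cut n (r + t.+1)
    + b * b + r * r + (g - 2) <= wiener H + b + r.
Proof.
have cH : #|H| = n by rewrite card_ord.
pose A := [set u : H | m.*2 <= u < m.*2 + b]; pose B := [set u : H | m.*2 + b <= u < n].
have cA : #|A| = b by rewrite card_ext_interval // ?leq_addr // addKn.
have cB : #|B| = r by rewrite card_ext_interval.
pose Z := [set u : H | 0 <= u < 1]; pose P := [set u : H | g - 2 <= u < g - 1].
have cZ : #|Z| = 1 by rewrite card_ext_interval //; move: hm hb; clear; lia.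
have cP : #|P| = 1.
  by rewrite card_ext_interval; move: hm hb hg; clear; lia.
have sum_diag (X : H -> nat) : \sum_(u : H) \sum_(v : H) (u == v) * X u = \sum_(u : H) X u.
  apply: eq_bigr => u _; rewrite (bigD1 u) //= eqxx mul1n big1 ?addn0 // => v ne_v.
  by rewrite eq_sym (negbTE ne_v).
have split_ge (f1 f2 f3 f4 f5 : H -> H -> nat) a :
    \sum_u \sum_v (f1 u v + 2 * f2 u v + 2 * f3 u v + a * (f4 u v + f5 u v)) =
    \sum_u \sum_v f1 u v + 2 * (\sum_u \sum_v f2 u v) + 2 * (\sum_u \sum_v f3 u v)
    + a * (\sum_u \sum_v f4 u v + \sum_u \sum_v f5 u v).
  rewrite -!big_split !big_distrr -!big_split; apply: eq_bigr => u _ /=.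
  by rewrite -!big_split !big_distrr -!big_split.
have split_le (f1 f2 : H -> H -> nat) :
    \sum_u \sum_v (f1 u v + 2 * f2 u v) = \sum_u \sum_v f1 u v + 2 * (\sum_u \sum_v f2 u v).
  rewrite !big_distrr -!big_split; apply: eq_bigr => u _ /=.
  by rewrite !big_distrr -!big_split.
have le_sums : \sum_(u : H) \sum_(v : H) (gap (coord u) (coord v) +
    2 * ((u \in A) * (v \in A)) + 2 * ((u \in B) * (v \in B)) +
    (g - 2) * ((u \in Z) * (v \in P) + (u \in P) * (v \in Z))) <=
  \sum_(u : H) \sum_(v : H) (dist u v + 2 * ((u == v) * ((u \in A) + (u \in B)))).
  apply: leq_sum => u _; apply: leq_sum => v _; have := dist_ext_ge u v.
  have inP (w : H) : (w \in P) = ((w : nat) == g - 2).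
    by rewrite inE; move: hg; clear; lia.
  have inZ (w : H) : (w \in Z) = ((w : nat) == 0) by rewrite inE ltnS leqn0.
  have inB (w : H) : (w \in B) = (m.*2 + b <= w) by rewrite inE ltn_ord andbT.
  by rewrite !inP !inZ !inB !inE.
rewrite split_ge split_le sum_diag big_split /= !card_reflect_sum in le_sums.
rewrite !sum_indicator sum_gap_coord -(wiener_double connH) cA cB cZ cP in le_sums.
by move: le_sums; clear; lia.
Qed.

End ExtremalWiener.


(** * Closed forms *)

(** From [4 cut n s = n ^ 2 - (n - 2s) ^ 2]: the differences [n - 2s] of the two halves are both
    [2j + 1] for odd [n], and [2j] and [2j + 2] for even [n]. *)
Lemma balanced_cutsE n j : j.*2.+1 <= n ->
  2 * balanced_cuts n (n - j.*2.+1) + j.*2.+1 ^ 2 + ~~ odd n = n ^ 2.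
Proof.
move=> le_j; rewrite /balanced_cuts /cut.
have [y [eq_n|eq_n]] : exists y, n = (j + y).*2.+1 \/ n = (j + y).*2.+2.
  by exists (n./2 - j - ~~ odd n); case: (boolP (odd n)) => ?; lia.
  have [-> ->] : (n - j.*2.+1)./2 = y /\ uphalf (n - j.*2.+1) = y by lia.
  have -> : n - y = j.*2 + y + 1 by lia.
  have -> : ~~ odd n = false by rewrite eq_n /= odd_double.
  by rewrite eq_n; nia.
have [-> ->] : (n - j.*2.+1)./2 = y /\ uphalf (n - j.*2.+1) = y.+1 by lia.
have -> : n - y = j.*2 + y + 2 by lia.
have -> : n - y.+1 = j.*2 + y + 1 by lia.
have -> : ~~ odd n = true by rewrite eq_n /= odd_double.
by rewrite eq_n; nia.
Qed.

Import Order.TTheory Num.Theory.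
Local Open Scope ring_scope.

Lemma sum_balanced_cutsE n k : (k.*2 <= n)%N ->
  (\sum_(j < k) balanced_cuts n (n - j.*2.+1))%N%:R =
  (k%:R * (n%:R ^+ 2 - (~~ odd n)%:R) - k%:R * (4 * k%:R ^+ 2 - 1) / 3) / 2 :> rat.
Proof.
elim: k => [|k IHk] le_k; first by rewrite big_ord0; field.
rewrite big_ord_recr /= natrD IHk; last by lia.
have := congr1 (fun x : nat => x%:R : rat) (@balanced_cutsE n k (ltac:(lia))).
move: (balanced_cuts _ _) => B.
rewrite !natrD !natrM -[k.*2.+1]addn1 natrD -muln2 natrM -[k.+1]addn1 natrD => eqB.
have -> : B%:R = (n%:R * n%:R - (k%:R * 2 + 1) * (k%:R * 2 + 1) - (~~ odd n)%:R) / 2 :> rat.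
  by lra.
by field.
Qed.

Lemma tree_boundE n k : (k.*2.+1 <= n)%N ->
  (tree_bound n k)%:R =
  (k%:R * (n%:R ^+ 2 - (~~ odd n)%:R) - k%:R * (4 * k%:R ^+ 2 - 1) / 3) / 2 +
  (n%:R - 2 * k%:R - 1) * (n%:R - 1) :> rat.
Proof.
move=> le_k; rewrite /tree_bound natrD sum_balanced_cutsE; last by lia.
congr (_ + _); rewrite natrM !natrB //; last by lia.
by rewrite -[k.*2.+1]addn1 natrD -muln2 natrM; ring.
Qed.

Lemma bound_small_tree_bound n m : (2 <= m)%N -> (2 * m <= n <= 2 * m + 2)%N ->
  bound_small n%:R m%:R = (tree_bound n m.-1)%:R - (n%:R - 2).
Proof.
move=> hm /andP[le1 le2]; rewrite tree_boundE; last by lia.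
have -> : m.-1%:R = m%:R - 1 :> rat by rewrite -subn1 natrB //; lia.
(* The two sides are different polynomials in [n]; they coincide at these three values with the
   parity of each. *)
have [->|[->|->]] : (n = 2 * m \/ n = 2 * m + 1 \/ n = 2 * m + 2)%N by lia.
- by rewrite oddM /= natrM /bound_small; field.
- by rewrite oddD oddM /= natrD natrM /bound_small; field.
- by rewrite oddD oddM /= natrD natrM /bound_small; field.
Qed.

Lemma bound_odd_tree_bound n m : (2 <= m)%N -> (2 * m <= n)%N -> odd n ->
  bound_odd n%:R m%:R = (tree_bound n m.-1)%:R - (n%:R + 2 * m%:R - 5).
Proof.
move=> hm le1 odd_n; rewrite tree_boundE; last by lia.
have -> : m.-1%:R = m%:R - 1 :> rat by rewrite -subn1 natrB //; lia.
by rewrite odd_n /= /bound_odd; field.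
Qed.

Lemma bound_even_tree_bound n m : (2 <= m)%N -> (2 * m <= n)%N -> ~~ odd n ->
  bound_even n%:R m%:R = (tree_bound n m.-1)%:R - (n%:R + 2 * m%:R - 6).
Proof.
move=> hm le1 odd_n; rewrite tree_boundE; last by lia.
have -> : m.-1%:R = m%:R - 1 :> rat by rewrite -subn1 natrB //; lia.
by rewrite odd_n /= /bound_even; field.
Qed.

Lemma unicyclic_traced (G : sgraph) : unicyclic G ->
  exists C c, [/\ connected_graph G, traces C c &
    forall C' : {set {set G}}, is_cycle C' -> C' = C].
Proof.
case=> connG [C [[c [c3 uc defC]] uniqC]]; exists C, c; split=> // C' /uniqC.
by move=> ->.
Qed.

Section UpperBounds.
Variables (n m : nat) (G : sgraph).
Hypotheses (hm : (2 <= m)%N) (hmn : (2 * m <= n)%N) (UG : in_U G n m).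

Lemma wiener_le_small : (n <= 2 * m + 2)%N -> (wiener G)%:R <= bound_small n%:R m%:R.
Proof.
move=> le_n; case: UG => /unicyclic_traced[C [c [connG tr uniqC]]] cG mG.
rewrite bound_small_tree_bound ?hmn //.
have := @wiener_upper_small G C n m.-1 connG uniqC cG.
rewrite mG => /(_ _ _ _ _ tr) H.
have : (wiener G + (n - 2) <= tree_bound n m.-1)%N by apply: H; lia.
rewrite -(ler_nat rat) natrD natrB; last by lia.
by rewrite lerBrDr.
Qed.

Lemma deficitR : (2 * m + 3 <= n)%N ->
  (deficit n m.-1)%:R = n%:R + 2 * m%:R - 5 - (~~ odd n)%:R :> rat.
Proof.
move=> le_n; have : (deficit n m.-1 + 5 + ~~ odd n = n + 2 * m)%N.
  by rewrite /deficit; case: (odd n); lia.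
move/(congr1 (fun x : nat => x%:R : rat)); rewrite mul2n !natrD -muln2 natrM => H.
by lra.
Qed.

Lemma wiener_le_large : (2 * m + 3 <= n)%N ->
  (wiener G)%:R <= (tree_bound n m.-1)%:R - (n%:R + 2 * m%:R - 5 - (~~ odd n)%:R) :> rat.
Proof.
move=> le_n; case: UG => /unicyclic_traced[C [c [connG tr uniqC]]] cG mG.
have := @wiener_upper_large G C n m.-1 connG uniqC cG.
rewrite mG => /(_ _ _ _ _ tr) H.
have : (wiener G + deficit n m.-1 <= tree_bound n m.-1)%N by apply: H; lia.
by rewrite -(ler_nat rat) natrD deficitR // lerBrDr.
Qed.

Lemma wiener_le_odd : (2 * m + 3 <= n)%N -> odd n -> (wiener G)%:R <= bound_odd n%:R m%:R.
Proof.
move=> le_n odd_n; rewrite bound_odd_tree_bound //.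
by have := wiener_le_large le_n; rewrite odd_n subr0.
Qed.

Lemma wiener_le_even : (2 * m + 4 <= n)%N -> ~~ odd n -> (wiener G)%:R <= bound_even n%:R m%:R.
Proof.
move=> le_n odd_n; rewrite bound_even_tree_bound //.
have := wiener_le_large (ltac:(lia) : (2 * m + 3 <= n)%N).
by rewrite odd_n /=; lra.
Qed.

End UpperBounds.


Lemma sum_cutE n x k : (x + k <= n.+1)%N ->
  (\sum_(j < k) cut n (x + j))%N%:R =
  k%:R * x%:R * (n%:R - x%:R) + (n%:R - 2 * x%:R) * (k%:R * (k%:R - 1)) / 2
  - k%:R * (k%:R - 1) * (2 * k%:R - 1) / 6 :> rat.
Proof.
elim: k => [|k IHk] le_k; first by rewrite big_ord0; field.
rewrite big_ord_recr /= natrD IHk; last by lia.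
rewrite /cut natrM natrB; last by lia.
by rewrite natrD -[k.+1]addn1 natrD; field.
Qed.

Lemma cutE n s : (s <= n)%N -> (cut n s)%:R = s%:R * (n%:R - s%:R) :> rat.
Proof. by move=> le_s; rewrite /cut natrM natrB. Qed.


(** * Attaining the bounds *)

Section Sharpness.
Variables n m b g : nat.
Hypothesis hm : (2 <= m)%N.
Hypothesis hb : (m.*2 + b <= n)%N.
Hypothesis hg : (g == 3)%N && (m.*2 + b == n)%N || (g == 4)%N.
Local Notation H := (@ext_graph n m b g hm hb hg).

Lemma ext_in_U : in_U H n m.
Proof.
split; first exact: ext_unicyclic.
  by rewrite card_ord.
by apply/eqP; rewrite eqn_leq ext_matching_le ext_matching_ge.
Qed.

Lemma wiener_ext_geR q : q = (n - (m.*2 + b))%N ->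
  q%:R * (n%:R - q%:R) + (q%:R + 5 - g%:R) * (n%:R - (q%:R + 5 - g%:R))
  + ((2 * m%:R - 2) * (q%:R + 3) * (n%:R - (q%:R + 3))
     + (n%:R - 2 * (q%:R + 3)) * ((2 * m%:R - 2) * (2 * m%:R - 3)) / 2
     - (2 * m%:R - 2) * (2 * m%:R - 3) * (4 * m%:R - 5) / 6)
  + b%:R * b%:R + q%:R * q%:R + (g%:R - 2) - b%:R - q%:R <= (wiener H)%:R :> rat.
Proof.
move=> eq_q; have := wiener_ext_ge hm hb hg; rewrite -eq_q.
have -> : (\sum_(2 <= t < m.*2) cut n (q + t.+1) =
           \sum_(j < m.*2 - 2) cut n (q + 3 + j))%N.
  rewrite -{1}[2%N]add0n big_addn big_mkord; apply: eq_bigr => j _.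
  by congr (cut n _); lia.
have g34 : (3 <= g <= 4)%N by move: hg; clear; lia.
have le_qn : (q + 3 <= n)%N by move: eq_q hb hm; clear; lia.
rewrite -(ler_nat rat) !natrD sum_cutE; last by move: eq_q hb hm; clear; lia.
rewrite !cutE; try by move: g34 le_qn; clear; lia.
rewrite !natrD !natrM !natrB; try by move: g34 hm; clear; lia.
rewrite -muln2 natrM.
by lra.
Qed.

End Sharpness.

Theorem theorem1p4 (n m : nat) (hm : (2 <= m)%N) (hmn : (m <= n %/ 2)%N) :
  (forall G : sgraph, in_U G n m ->
     [/\ (n <= 2 * m + 2)%N -> (wiener G)%:R <= bound_small n%:R m%:R,
         (2 * m + 3 <= n)%N -> odd n -> (wiener G)%:R <= bound_odd n%:R m%:R
       & (2 * m + 4 <= n)%N -> ~~ odd n ->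
           (wiener G)%:R <= bound_even n%:R m%:R])
  /\
  [/\ (n <= 2 * m + 2)%N ->
        exists2 G : sgraph, in_U G n m & (wiener G)%:R = bound_small n%:R m%:R,
      (2 * m + 3 <= n)%N -> odd n ->
        exists2 G : sgraph, in_U G n m & (wiener G)%:R = bound_odd n%:R m%:R
    & (2 * m + 4 <= n)%N -> ~~ odd n ->
        exists2 G : sgraph, in_U G n m & (wiener G)%:R = bound_even n%:R m%:R].
Proof.
have le_mn : (2 * m <= n)%N by rewrite mulnC -leq_divRL.
split.
  move=> G UG; split; first exact: wiener_le_small.
    exact: wiener_le_odd.
  exact: wiener_le_even.
split.
(* A triangle at one end of the path and all [n - 2m] leaves at the other. *)
- move=> le_n; have hb : (m.*2 + (n - m.*2) <= n)%N by lia.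
  have hg : (3 == 3)%N && (m.*2 + (n - m.*2) == n)%N || (3 == 4)%N by lia.
  have UH := ext_in_U hm hb hg; exists (ext_graph hm hb hg) => //.
  (* The upper bound holds for the witness itself, so a matching lower estimate is enough; it has
     the same closed form as the bound. *)
  apply/le_anti; rewrite (wiener_le_small hm le_mn UH le_n) /=.
  apply: le_trans (wiener_ext_geR hm hb hg (q := 0) _); last by lia.
  have -> : (n - m.*2)%:R = n%:R - 2 * m%:R :> rat.
    by rewrite natrB; [rewrite -muln2 natrM mulrC | lia].
  rewrite /bound_small le_eqVlt; apply/orP; left; apply/eqP.
  by field.
(* A 4-cycle with [q] leaves at vertex 1 and [q + 1] at vertex [2m - 1], as even a split of the odd
   number [n - 2m] as possible. *)
- move=> le_n odd_n; pose q := (n - (m.*2).+1)./2.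
  have eq_n : n = (m.*2 + q.+1 + q)%N by rewrite /q; lia.
  have hb : (m.*2 + q.+1 <= n)%N by lia.
  have hg : (4 == 3)%N && (m.*2 + q.+1 == n)%N || (4 == 4)%N by lia.
  have UH := ext_in_U hm hb hg; exists (ext_graph hm hb hg) => //.
  apply/le_anti; rewrite (wiener_le_odd hm le_mn UH le_n odd_n) /=.
  apply: le_trans (wiener_ext_geR hm hb hg (q := q) _); last by lia.
  have -> : n%:R = 2 * m%:R + q%:R + 1 + q%:R :> rat.
    by rewrite {1}eq_n !natrD -[q.+1]addn1 natrD -muln2 natrM; ring.
  rewrite -[q.+1]addn1 natrD /bound_odd le_eqVlt; apply/orP; left; apply/eqP.
  by field.
(* The same graph with [q] leaves at each of the two places. *)
- move=> le_n even_n; pose q := (n - m.*2)./2.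
  have eq_n : n = (m.*2 + q + q)%N by rewrite /q; lia.
  have hb : (m.*2 + q <= n)%N by lia.
  have hg : (4 == 3)%N && (m.*2 + q == n)%N || (4 == 4)%N by lia.
  have UH := ext_in_U hm hb hg; exists (ext_graph hm hb hg) => //.
  apply/le_anti; rewrite (wiener_le_even hm le_mn UH le_n even_n) /=.
  apply: le_trans (wiener_ext_geR hm hb hg (q := q) _); last by lia.
  have -> : n%:R = 2 * m%:R + q%:R + q%:R :> rat.
    by rewrite {1}eq_n !natrD -muln2 natrM; ring.
  rewrite /bound_even le_eqVlt; apply/orP; left; apply/eqP.
  by field.
Qed.
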